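(* Let $\Omega=\mathbb{R}\times[-1,1]$. For any $\alpha>0$ there exists $\epsilon_\alpha>0$ such that the following holds. If $\omega\in L^2(\Omega)$ is a traveling wave solution, with some speed $c\in\mathbb{R}$, of the Euler equations near Couette flow $\partial_t\omega+y\,\partial_x\omega+u\cdot\nabla\omega=0$, and $$\|\omega\|_{C^{1,\alpha}(\Omega)}\le\epsilon_\alpha,$$ then $\omega=0$.
   Context: Velocity: for $\omega$ on $\Omega=\mathbb{R}\times[-1,1]$, let $\psi$ solve $-\Delta\psi=\omega$ in the interior of $\Omega$ with $\psi=0$ on $\{y=\pm1\}$ (given by the Dirichlet Green function; for $\omega\in L^2(\Omega)$ it is the unique solution in $H^1_0(\Omega)$); the velocity is $u=(u^x,u^y)=(\partial_y\psi,-\partial_x\psi)$. The profile $\omega$ is a traveling wave solution with speed $c$ if $\omega(x-ct,y)$ solves the equation, i.e. $(y-c+u^x)\partial_x\omega+u^y\partial_y\omega=0$ in $\Omega$, where $u$ is generated by $\omega$. The constant $\epsilon_\alpha$ does not depend on $c$ or $\omega$. Hölder norm: $\|f\|_{C^{1,\alpha}(\Omega)}=\|f\|_{C^1(\Omega)}+\sup_{z\ne z'}\frac{|\nabla f(z)-\nabla f(z')|}{|z-z'|^\alpha}$. *)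

(* Defs.v *)
From HB Require Import structures.
From mathcomp Require Import all_boot all_order all_algebra.
From mathcomp Require Import all_classical all_reals all_analysis.

Set Implicit Arguments.
Unset Strict Implicit.
Unset Printing Implicit Defensive.

Import Order.TTheory GRing.Theory Num.Theory.
Import numFieldTopology.Exports numFieldNormedType.Exports.

Local Open Scope classical_set_scope.
Local Open Scope ring_scope.

Section Strip.
Context {R : realType}.

Definition strip : set (R * R) := [set z | -1 <= z.2 <= 1].

Definition strip_int : set (R * R) := [set z | -1 < z.2 < 1].

Definition ex : R * R := (1, 0).
Definition ey : R * R := (0, 1).

(* The norm of the library on R * R is the max norm. *)
Definition enorm (z : R * R) : R := Num.sqrt (z.1 ^+ 2 + z.2 ^+ 2).

Definition plane_measure :
  {measure set (measurableTypeR R * measurableTypeR R) -> \bar R} :=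
  [the measure _ _ of ((@lebesgue_measure R) \x (@lebesgue_measure R))%E].

Definition L2_on (A : set (R * R)) (f : R * R -> R) : Prop :=
  measurable_fun A f /\ finite_norm plane_measure 2%:E (f \_ A).

(* Directional derivatives relative to the closed strip: the increment h is
   restricted to z + h v in the strip, so that on the boundary lines y = 1 and
   y = -1 the derivative along ey is one-sided. At interior points this is the
   library's 'D_v (lemma strip_deriveE below). *)
Definition strip_derivable (f : R * R -> R) (z v : R * R) : Prop :=
  cvg ((fun h : R => h^-1 *: ((f \o shift z) (h *: v) - f z)) @
       within [set h | strip (h *: v + z)] 0^').

Definition strip_derive (f : R * R -> R) (z v : R * R) : R :=
  lim ((fun h : R => h^-1 *: ((f \o shift z) (h *: v) - f z)) @
       within [set h | strip (h *: v + z)] 0^').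

Definition strip_grad (f : R * R -> R) (z : R * R) : R * R :=
  (strip_derive f z ex, strip_derive f z ey).

Definition C1_strip (f : R * R -> R) : Prop :=
  [/\ {within strip, continuous f},
      forall z, strip z -> strip_derivable f z ex /\ strip_derivable f z ey &
      {within strip, continuous (strip_grad f)}].

Local Open Scope ereal_scope.

Definition C1_norm (f : R * R -> R) : \bar R :=
  ereal_sup [set `|f z|%:E | z in strip] +
  ereal_sup [set (enorm (strip_grad f z))%:E | z in strip].

Definition holder_seminorm (alpha : R) (g : R * R -> R * R) : \bar R :=
  ereal_sup [set (enorm (g p.1 - g p.2) / enorm (p.1 - p.2) `^ alpha)%:E
            | p in [set p | [/\ strip p.1, strip p.2 & p.1 <> p.2]]].

(* Meaningful under C1_strip f; otherwise strip_grad may take default values. *)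
Definition C1alpha_norm (alpha : R) (f : R * R -> R) : \bar R :=
  C1_norm f + holder_seminorm alpha (strip_grad f).

Local Close Scope ereal_scope.

Definition C1_int (f : R * R -> R) : Prop :=
  forall z, strip_int z ->
    [/\ derivable f z ex, derivable f z ey,
        {for z, continuous ('D_ex f)} & {for z, continuous ('D_ey f)}].

Definition C2_int (f : R * R -> R) : Prop :=
  [/\ C1_int f, C1_int ('D_ex f) & C1_int ('D_ey f)].

Definition laplacian (f : R * R -> R) (z : R * R) : R :=
  'D_ex ('D_ex f) z + 'D_ey ('D_ey f) z.

(* psi is the H^1_0 solution of - Laplacian psi = omega. For a function that is
   continuous on the closed strip and C^2 inside, being in H^1_0 means vanishing
   on y = 1 and y = -1, and being square-integrable together with its gradient.
   When omega is in L^2 and C^1 on the closed strip, the H^1_0 solution has this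
   regularity. *)
Record stream_function (omega psi : R * R -> R) : Prop := {
  stream_C2 : C2_int psi;
  stream_poisson : forall z, strip_int z -> - laplacian psi z = omega z;
  stream_continuous : {within strip, continuous psi};
  stream_top : forall x, psi (x, 1) = 0;
  stream_bottom : forall x, psi (x, -1) = 0;
  stream_L2 : L2_on strip psi;
  stream_dx_L2 : L2_on strip_int ('D_ex psi);
  stream_dy_L2 : L2_on strip_int ('D_ey psi) }.

Definition velocity (psi : R * R -> R) (z : R * R) : R * R :=
  ('D_ey psi z, - 'D_ex psi z).

Definition traveling_wave (c : R) (omega : R * R -> R) : Prop :=
  exists2 psi, stream_function omega psi &
    forall z, strip_int z ->
      (z.2 - c + (velocity psi z).1) * 'D_ex omega z
        + (velocity psi z).2 * 'D_ey omega z = 0.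

Lemma strip_int_near (z v : R * R) : strip_int z ->
  \forall h \near (0 : R)^', strip (h *: v + z).
Proof.
move=> /andP[z1 z2].
have hc : (fun h : R => h * v.2 + z.2) @ (0 : R)^' --> z.2.
  have -> : nbhs z.2 = nbhs (0 * v.2 + z.2) by rewrite mul0r add0r.
  apply: (@cvgD R R R^o); last exact: cvg_cst.
  by apply: (@cvgMr_tmp R R); exact: nbhs_dnbhs.
have h1 : \forall h \near (0 : R)^', -1 < h * v.2 + z.2.
  exact: hc (lt_nbhsr z1).
have h2 : \forall h \near (0 : R)^', h * v.2 + z.2 < 1.
  exact: hc (lt_nbhsl z2).
near=> h; apply/andP; split => /=; apply: ltW.
- by near: h.
- by near: h.
Unshelve. all: by end_near. Qed.

Lemma strip_within (z v : R * R) : strip_int z ->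
  within [set h : R | strip (h *: v + z)] (0 : R)^' = (0 : R)^'.
Proof.
move=> zi; apply/seteqP; split => A; rewrite /within /=; last first.
  by move=> hA; apply: filterS hA => h ? _.
by move=> hA; have := strip_int_near v zi; apply: filterS2 hA => h; apply.
Qed.

Lemma strip_deriveE (f : R * R -> R) (z v : R * R) : strip_int z ->
  strip_derive f z v = 'D_v f z.
Proof. by move=> zi; rewrite /strip_derive strip_within. Qed.

Lemma strip_derivableE (f : R * R -> R) (z v : R * R) : strip_int z ->
  strip_derivable f z v = derivable f z v.
Proof. by move=> zi; rewrite /strip_derivable strip_within. Qed.

End Strip.

(* Main.v *)
Require Import Defs.
From mathcomp Require Import all_boot all_order all_algebra.
From mathcomp Require Import ring lra.
From mathcomp Require Import all_classical all_reals all_analysis.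
From mathcomp Require Import measurable_realfun.
Set Implicit Arguments.
Unset Strict Implicit.
Unset Printing Implicit Defensive.
Import Order.TTheory GRing.Theory Num.Theory.
Import numFieldTopology.Exports numFieldNormedType.Exports.
Local Open Scope classical_set_scope.
Local Open Scope ring_scope.

(** Differentiating the Poisson equation in x and using the transport equation,
    phi = psi_x satisfies - Lap phi = omega_x = omega_y / (y - c + psi_y) phi.
    Maximum principles give |psi_xx| <= 2 eps, hence y - c + psi_y is increasing
    in y with slope at least 1/2 and vanishes on at most one point eta of each
    vertical line. There either omega_y (eta) = 0, and the quotient is
    O(eps |y - eta|^(alpha - 1)) by Hoelder continuity, or phi (eta) = 0, and
    phi^2 / |y - eta| is at most the integral of phi_y^2. In both cases the
    integral over the vertical line of omega_x phi is at most C eps times that of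
    phi_y^2. Therefore E(x), the integral of phi^2 over the vertical line, has
    E'' >= c E; being bounded, it vanishes. So psi does not depend on x, and it
    is zero because psi_y is in L^2. As psi is only C^2, the argument is run on
    difference quotients of psi in x, with an error that vanishes with the step. *)

(** * One-variable calculus *)

(** The speed [c] only moves the zero of y - c + psi_y. If that zero leaves the open strip, the wall
    on its side plays the role of eta; phi vanishes there, so the second case applies and no bound
    on the speed is needed. The bound on psi_xx has to hold with an explicit multiple of eps. It
    comes from comparison functions alone: doubling the variables bounds the increments of the
    difference quotients of psi by 2 eps times the translation, uniformly in the step. Then 1 +
    psi_yy = 1 - omega - psi_xx >= 1 - 3 eps, whence the requirement eps <= 1/6. The inequality for
    E'' is used only at an approximate maximum of E. The supremum of E need not be attained, so a
    small multiple of a square is subtracted first; at the resulting maximum the second differences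
    of E are nearly nonpositive, and E is small there. Square integrability of psi_y provides
    vertical lines, arbitrarily far on both sides, along which psi is uniformly small. They replace
    conditions at infinity. *)

Section Calculus.
Context {R : realType}.
Implicit Types (f g df : R -> R) (a b t s u x y : R).

Lemma continuous_within_segment f a b :
  (forall x, a <= x <= b -> {for x, continuous f}) ->
  {within `[a, b], continuous f}.
Proof.
move=> cf; apply: continuous_in_subspaceT => x; rewrite inE /= in_itv /=.
exact: cf.
Qed.

Lemma mean_value f df a b : a < b ->
  (forall x, a < x < b -> is_derive x 1 f (df x)) ->
  (forall x, a <= x <= b -> {for x, continuous f}) ->
  exists2 c, a < c < b & f b - f a = df c * (b - a).
Proof.
move=> ab dfE cf; have dfE' x : x \in `]a, b[ -> is_derive x 1 f (df x).
  by rewrite in_itv /=; exact: dfE.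
have [c] := MVT ab dfE' (continuous_within_segment cf).
by rewrite in_itv /= => cab e; exists c.
Qed.

Lemma derive_cont f x l : is_derive x 1 f l -> {for x, continuous f}.
Proof.
move=> [d _]; apply: differentiable_continuous; exact/derivable1_diffP.
Qed.

Lemma derive_ge0_le f df a b : a <= b ->
  (forall x, a <= x <= b -> {for x, continuous f}) ->
  (forall x, a < x < b -> is_derive x 1 f (df x)) ->
  (forall x, a < x < b -> 0 <= df x) -> f a <= f b.
Proof.
rewrite le_eqVlt => /predU1P[->//|ab] cf dfE df0.
have [c cab e] := mean_value ab dfE cf.
by rewrite -subr_ge0 e mulr_ge0 ?df0// subr_ge0 ltW.
Qed.

(** Serves for primitives of functions with an integrable singularity at [c]: continuity at [c] is
    enough to join the two sides. *)
Lemma derive_ge0_le_except f df a b c : a <= b ->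
  (forall x, a <= x <= b -> {for x, continuous f}) ->
  (forall x, a < x < b -> x != c -> is_derive x 1 f (df x)) ->
  (forall x, a < x < b -> x != c -> 0 <= df x) -> f a <= f b.
Proof.
move=> ab cf dfE df0.
have [cab|cab] := boolP (a < c < b); last first.
  apply: (@derive_ge0_le f df) => // x xab; have xc : x != c.
  - by apply: contraNneq cab => <-.
  - exact: dfE.
  - by apply: contraNneq cab => <-.
  - exact: df0.
have /andP[ac cb] := cab.
apply: (@le_trans _ _ (f c)); apply: (@derive_ge0_le f df); try exact: ltW.
- by move=> x /andP[x1 x2]; apply: cf; rewrite x1 (le_trans x2 (ltW cb)).
- by move=> x /andP[x1 x2]; apply: dfE; rewrite ?x1 ?(lt_trans x2 cb)// lt_eqF.
- by move=> x /andP[x1 x2]; apply: df0; rewrite ?x1 ?(lt_trans x2 cb)// lt_eqF.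
- by move=> x /andP[x1 x2]; apply: cf; rewrite x2 (le_trans (ltW ac) x1).
- by move=> x /andP[x1 x2]; apply: dfE; rewrite ?x2 ?(lt_trans ac x1)// gt_eqF.
- by move=> x /andP[x1 x2]; apply: df0; rewrite ?x2 ?(lt_trans ac x1)// gt_eqF.
Qed.

(** The derivatives are carried as explicit functions, so that those of translates, differences and
    comparison functions are known by their formulas. *)
Definition C2on (I : set R) g g1 g2 := forall u, I u ->
  [/\ is_derive u 1 g (g1 u), is_derive u 1 g1 (g2 u) & {for u, continuous g2}].

Lemma C2on_sub I f f1 f2 g g1 g2 : C2on I f f1 f2 -> C2on I g g1 g2 ->
  C2on I (f \- g) (f1 \- g1) (f2 \- g2).
Proof.
move=> cf cg u Iu; have [d1 d2 c2] := cf _ Iu; have [e1 e2 k2] := cg _ Iu.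
by split; [exact: is_deriveB|exact: is_deriveB|exact: continuousB].
Qed.

Lemma C2on_scale I k f f1 f2 : C2on I f f1 f2 ->
  C2on I (fun x => k * f x) (fun x => k * f1 x) (fun x => k * f2 x).
Proof.
move=> cf u Iu; have [d1 d2 c2] := cf _ Iu.
by split; [exact: is_deriveZ|exact: is_deriveZ|
  apply: continuousM => //; exact: cst_continuous].
Qed.

Lemma C2on_cst I k : C2on I (fun=> k) (fun=> 0) (fun=> 0).
Proof.
by move=> u _; split; [exact: is_derive_cst|exact: is_derive_cst|
  exact: cst_continuous].
Qed.

Lemma C2on_quad I k0 k1 k2 :
  C2on I (fun x => k0 + k1 * x + k2 * x ^+ 2) (fun x => k1 + 2 * k2 * x)
    (fun=> 2 * k2).
Proof.
move=> u _; split; last exact: cst_continuous.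
- by apply: is_derive_eq; rewrite /GRing.scale /=; ring.
- by apply: is_derive_eq; rewrite /GRing.scale /=; ring.
Qed.

Lemma is_derive_shift f x h l :
  is_derive (x + h) 1 f l -> is_derive x 1 (fun z => f (z + h)) l.
Proof.
move=> d; have d1 : is_derive x 1 (fun z : R => z + h) 1.
  by apply: is_derive_eq; rewrite addr0.
by have := @is_derive1_comp _ f (fun z => z + h) x _ _ d d1; rewrite mulr1.
Qed.

Lemma C2on_shift f f1 f2 h : C2on setT f f1 f2 ->
  C2on setT (fun x => f (x + h)) (fun x => f1 (x + h)) (fun x => f2 (x + h)).
Proof.
move=> cf u _; have [d1 d2 c2] := cf (u + h) I.
split; [exact: is_derive_shift|exact: is_derive_shift|].
apply: (@continuous_comp _ _ _ (fun z => z + h) f2) => //.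
by apply: continuousD; [exact: id|exact: cst_continuous].
Qed.

Lemma second_difference g g1 g2 t s :
  0 < s -> (forall u, `|u - t| <= s -> is_derive u 1 g (g1 u)) ->
  (forall u, `|u - t| <= s -> is_derive u 1 g1 (g2 u)) ->
  exists2 xi, `|xi - t| < s & g (t + s) + g (t - s) - 2 * g t = s ^+ 2 * g2 xi.
Proof.
move=> s0 d1 d2.
(* [C] is the value for which [k s = k 0]. *)
pose C := (g (t + s) + g (t - s) - 2 * g t) / s ^+ 2.
pose k u := g (u + t) + g (- u + t) - C * u ^+ 2.
pose dk u := g1 (t + u) - g1 (t - u) - 2 * C * u.
have kd u : 0 <= u <= s -> is_derive u 1 k (dk u).
  move=> /andP[u0 us].
  have e1 : is_derive (u + t) 1 g (g1 (t + u)).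
    by rewrite addrC; apply: d1; rewrite addrAC subrr add0r ger0_norm.
  have e2 : is_derive (- u + t) 1 g (g1 (t - u)).
    by rewrite addrC; apply: d1; rewrite addrAC subrr add0r normrN ger0_norm.
  have f1 : is_derive u 1 (fun u => u + t) 1.
    by apply: is_derive_eq; rewrite addr0.
  have f2 : is_derive u 1 (fun u => - u + t) (- 1).
    by apply: is_derive_eq; rewrite addr0.
  have h1 := @is_derive1_comp _ g (fun u => u + t) u _ _ e1 f1.
  have h2 := @is_derive1_comp _ g (fun u => - u + t) u _ _ e2 f2.
  have h3 : is_derive u 1 (fun u => C * u ^+ 2) (2 * C * u).
    by apply: is_derive_eq; rewrite /GRing.scale /=; ring.
  have := is_deriveB (is_deriveD h1 h2) h3.
  by move=> h; apply: is_derive_eq; rewrite /dk; ring.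
have [u|u|u1 /andP[u10 u1s] e] := @mean_value k dk 0 s s0.
- by move=> /andP[u0 us]; apply: kd; rewrite !ltW.
- by move=> uu; apply: derive_cont (kd _ uu).
have kk : k s = k 0.
  rewrite /k /C oppr0 !add0r expr0n /= mulr0 subr0.
  by rewrite divfK ?expf_eq0 ?gt_eqF// [s + t]addrC [- s + t]addrC; ring.
have dk0 : dk u1 = 0.
  move: e; rewrite kk subrr => /esym/eqP; rewrite subr0 mulf_eq0.
  by rewrite (gt_eqF s0) orbF => /eqP.
have [|x /andP[x1 x2]|x /andP[x1 x2]|xi /andP[x1 x2] e2] :=
  @mean_value g1 g2 (t - u1) (t + u1).
- by lra.
- by apply: d2; rewrite ler_norml; lra.
- apply: derive_cont; apply: d2; rewrite ler_norml; lra.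
exists xi; first by rewrite ltr_norml; lra.
have {}e2 : C = g2 xi.
  apply: (@mulIf _ (2 * u1)); first by rewrite mulf_neq0// gt_eqF.
  by move: dk0; rewrite /dk e2; lra.
by rewrite -e2 /C [RHS]mulrC divfK// expf_eq0 gt_eqF.
Qed.

Lemma cont_near g t e : 0 < e -> {for t, continuous g} ->
  exists2 r, 0 < r & forall u, `|u - t| < r -> `|g u - g t| < e.
Proof.
move=> e0 /cvgrPdist_lt /(_ _ e0) /nbhs_ballP[r /= r0 h].
exists r => // u ur; rewrite distrC; apply: h => /=.
by rewrite /ball /= distrC.
Qed.

(** At a local maximum the centred second difference is nonpositive, while [second_difference] makes
    it a positive multiple of [g2] at a point close to [t]. *)
Lemma second_derivative_max I g g1 g2 t r : 0 < r ->
  (forall u, `|u - t| < r -> I u) -> C2on I g g1 g2 ->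
  (forall u, `|u - t| < r -> g u <= g t) -> g2 t <= 0.
Proof.
move=> r0 rI cg mg; rewrite leNgt; apply/negP => g20.
have It : I t by apply: rI; rewrite subrr normr0.
have [_ _ c2] := cg _ It.
have [r1 r10 h] := cont_near g20 c2.
pose s := Num.min r r1 / 2.
have m0 : 0 < Num.min r r1 by rewrite lt_min r0.
have s0 : 0 < s by rewrite /s divr_gt0.
have sr : s < r.
  have : Num.min r r1 <= r by rewrite ge_min lexx.
  by rewrite /s; lra.
have sr1 : s < r1.
  have : Num.min r r1 <= r1 by rewrite ge_min lexx orbT.
  by rewrite /s; lra.
have [u us|u us|xi xis e] := @second_difference g g1 g2 t s s0.
- by have [] := cg u (rI _ (le_lt_trans us sr)).
- by have [] := cg u (rI _ (le_lt_trans us sr)).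
have h1 := mg (t + s); have h2 := mg (t - s).
have := h xi (lt_trans xis sr1); rewrite ltr_norml => /andP[hh _].
have : s ^+ 2 * g2 xi <= 0.
  rewrite -e.
  have /h1 : `|t + s - t| < r by rewrite addrAC subrr add0r gtr0_norm.
  have /h2 : `|t - s - t| < r by rewrite addrAC subrr add0r normrN gtr0_norm.
  lra.
rewrite pmulr_rle0 ?exprn_gt0//; lra.
Qed.

End Calculus.

(** * Dirichlet energy on a segment *)

Section OneDim.
Context {R : realType}.
Implicit Types (f g df : R -> R) (a b t s u x y : R).

Lemma ge0_left_end f a b : a < b -> {for a, continuous f} ->
  (forall y, a < y < b -> 0 <= f y) -> 0 <= f a.
Proof.
move=> ab cf h; rewrite leNgt; apply/negP => fa0.
have [|r r0 hr] := cont_near _ cf (e := - f a); first by rewrite oppr_gt0.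
pose y := a + Num.min r (b - a) / 2.
have m0 : 0 < Num.min r (b - a) by rewrite lt_min r0 subr_gt0.
have m1 : Num.min r (b - a) <= r by rewrite ge_min lexx.
have m2 : Num.min r (b - a) <= b - a by rewrite ge_min lexx orbT.
have /h : a < y < b by rewrite /y; lra.
have /hr : `|y - a| < r by rewrite ltr_norml /y; lra.
by rewrite ltr_norml; lra.
Qed.

Lemma ge0_right_end f a b : a < b -> {for b, continuous f} ->
  (forall y, a < y < b -> 0 <= f y) -> 0 <= f b.
Proof.
move=> ab cf h; rewrite leNgt; apply/negP => fa0.
have [|r r0 hr] := cont_near _ cf (e := - f b); first by rewrite oppr_gt0.
pose y := b - Num.min r (b - a) / 2.
have m0 : 0 < Num.min r (b - a) by rewrite lt_min r0 subr_gt0.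
have m1 : Num.min r (b - a) <= r by rewrite ge_min lexx.
have m2 : Num.min r (b - a) <= b - a by rewrite ge_min lexx orbT.
have /h : a < y < b by rewrite /y; lra.
have /hr : `|y - b| < r by rewrite ltr_norml /y; lra.
by rewrite ltr_norml; lra.
Qed.

(* Cauchy-Schwarz for dg, without integrals: P - 2 l g + l^2 x is nondecreasing
   for every l, in particular for l = (g b - g a) / (b - a). *)
Lemma sqr_increment_le P dP g dg a b : a < b ->
  (forall x, a <= x <= b -> {for x, continuous P}) ->
  (forall x, a <= x <= b -> {for x, continuous g}) ->
  (forall x, a < x < b -> is_derive x 1 P (dP x)) ->
  (forall x, a < x < b -> is_derive x 1 g (dg x)) ->
  (forall x, a < x < b -> dg x ^+ 2 <= dP x) ->
  (g b - g a) ^+ 2 <= (P b - P a) * (b - a).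
Proof.
move=> ab cP cg dPE dgE le2.
have ba0 : 0 < b - a by rewrite subr_gt0.
pose l := (g b - g a) / (b - a).
pose Q x := P x - 2 * l * g x + l ^+ 2 * x.
have : Q a <= Q b.
  apply: (@derive_ge0_le _ _ (fun x => dP x - 2 * l * dg x + l ^+ 2)).
  - exact: ltW.
  - move=> x xab; apply: continuousD; first apply: continuousB.
    + exact: cP.
    + by apply: continuousM; [exact: cst_continuous|exact: cg].
    + by apply: continuousM; [exact: cst_continuous|exact: id].
  - move=> x xab; have e1 := dPE _ xab; have e2 := dgE _ xab.
    by apply: is_derive_eq; rewrite /GRing.scale /=; ring.
  - move=> x xab; have e1 := le2 _ xab.
    have : 0 <= (dg x - l) ^+ 2 by exact: sqr_ge0.
    by rewrite sqrrB; move: e1; lra.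
have lE : g b - g a = l * (b - a) by rewrite /l divfK// gt_eqF.
rewrite /Q => h.
have {h} : l ^+ 2 * (b - a) <= P b - P a.
  have : 2 * l * (g b - g a) = 2 * l ^+ 2 * (b - a) by rewrite lE; ring.
  by move: h; lra.
rewrite -(ler_pM2r ba0); apply: le_trans.
by rewrite lE exprMn expr2 [(b - a) ^+ 2]expr2 !mulrA.
Qed.

(* F stands for the antiderivative of g g'', so that F (-1) - F 1 is the
   Dirichlet energy of g; g g' - F is nondecreasing, and as g vanishes at both
   ends g g' is <= 0 (>= 0) at points arbitrarily close to 1 (-1). *)
Lemma dirichlet_energy g g1 g2 F :
  (forall y, -1 <= y <= 1 -> {for y, continuous g}) ->
  (forall y, -1 <= y <= 1 -> {for y, continuous F}) ->
  g (-1) = 0 -> g 1 = 0 ->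
  (forall y, -1 < y < 1 -> is_derive y 1 g (g1 y)) ->
  (forall y, -1 < y < 1 -> is_derive y 1 g1 (g2 y)) ->
  (forall y, -1 < y < 1 -> is_derive y 1 F (g y * g2 y)) ->
  forall y z, -1 <= y -> y < z -> z <= 1 ->
  (g z - g y) ^+ 2 <= (F (-1) - F 1) * (z - y).
Proof.
move=> cg cF gN1 g1E dg dg1 dF.
pose P y := g y * g1 y - F y.
have dP y : -1 < y < 1 -> is_derive y 1 P (g1 y ^+ 2).
  move=> yI; have e1 := dg _ yI; have e2 := dg1 _ yI; have e3 := dF _ yI.
  by apply: is_derive_eq; rewrite /GRing.scale /=; ring.
have Pmono y z : -1 < y -> y <= z -> z < 1 -> P y <= P z.
  move=> y1 yz z1; apply: (@derive_ge0_le _ P (fun y => g1 y ^+ 2)) => //.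
  - by move=> x xyz; apply: derive_cont (dP _ _); lra.
  - by move=> x xyz; apply: dP; lra.
  - by move=> x _; exact: sqr_ge0.
have dg2 y : -1 < y < 1 -> is_derive y 1 (fun y => g y ^+ 2) (2 * (g y * g1 y)).
  by move=> yI; have e1 := dg _ yI; apply: is_derive_eq; rewrite /GRing.scale /=; ring.
have cg2 y : -1 <= y <= 1 -> {for y, continuous (fun y => g y ^+ 2)}.
  by move=> /cg cgy; apply: (@continuousM _ _ g g).
have Pr z : -1 < z < 1 -> P z <= - F 1.
  move=> /andP[z1 z2]; rewrite -subr_ge0.
  apply/ler_addgt0Pr => e e0.
  have [r r0 hr] := cont_near e0 (cF 1 ltac:(lra)).
  pose w := 1 - Num.min r (1 - z) / 2.
  have m0 : 0 < Num.min r (1 - z) by rewrite lt_min r0 subr_gt0.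
  have m1 : Num.min r (1 - z) <= r by rewrite ge_min lexx.
  have m2 : Num.min r (1 - z) <= 1 - z by rewrite ge_min lexx orbT.
  have w1 : w < 1 by rewrite /w; lra.
  have [||xi xiI] := mean_value w1 (f := fun y => g y ^+ 2) (df := fun y => 2 * (g y * g1 y)).
  - by move=> x xI; apply: dg2; move: xI; rewrite /w; lra.
  - by move=> x xI; apply: cg2; move: xI; rewrite /w; lra.
  rewrite g1E => e1.
  have gg1 : g xi * g1 xi <= 0.
    have : 0 <= g w ^+ 2 by exact: sqr_ge0.
    rewrite leNgt => w20; apply/negP => h; move: w20; apply/negP; rewrite -leNgt.
    have : 0 < 2 * (g xi * g1 xi) * (1 - w) by apply: mulr_gt0; [apply: mulr_gt0|]; lra.
    by rewrite -e1; lra.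
  have Pm : P z <= P xi by apply: Pmono => //; move: xiI; rewrite /w; lra.
  have PE : P xi = g xi * g1 xi - F xi by [].
  have /hr : `|xi - 1| < r by move: xiI; rewrite ltr_norml /w; lra.
  by rewrite ltr_norml; lra.
have Pl z : -1 < z < 1 -> - F (-1) <= P z.
  move=> /andP[z1 z2]; rewrite -subr_ge0.
  apply/ler_addgt0Pr => e e0.
  have [r r0 hr] := cont_near e0 (cF (-1) ltac:(lra)).
  pose w := -1 + Num.min r (1 + z) / 2.
  have m0 : 0 < Num.min r (1 + z) by rewrite lt_min r0; lra.
  have m1 : Num.min r (1 + z) <= r by rewrite ge_min lexx.
  have m2 : Num.min r (1 + z) <= 1 + z by rewrite ge_min lexx orbT.
  have w1 : -1 < w by rewrite /w; lra.
  have [||xi xiI] := mean_value w1 (f := fun y => g y ^+ 2) (df := fun y => 2 * (g y * g1 y)).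
  - by move=> x xI; apply: dg2; move: xI; rewrite /w; lra.
  - by move=> x xI; apply: cg2; move: xI; rewrite /w; lra.
  rewrite gN1 => e1.
  have gg1 : 0 <= g xi * g1 xi.
    have : 0 <= g w ^+ 2 by exact: sqr_ge0.
    rewrite leNgt => w20; rewrite leNgt; apply/negP => h; move: w20; apply/negP; rewrite -leNgt.
    have : 0 < 2 * - (g xi * g1 xi) * (w - -1) by apply: mulr_gt0; [apply: mulr_gt0|]; lra.
    by lra.
  have Pm : P xi <= P z by apply: Pmono => //; move: xiI; rewrite /w; lra.
  have PE : P xi = g xi * g1 xi - F xi by [].
  have /hr : `|xi - -1| < r by move: xiI; rewrite ltr_norml /w; lra.
  by rewrite ltr_norml; lra.
(* [P] is a primitive of [g1 ^+ 2], and by [Pl] and [Pr] its increments inside the segment are at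
   most [F (-1) - F 1]. The end points are reached afterwards by continuity. *)
have main y z : -1 < y -> y < z -> z < 1 ->
    (g z - g y) ^+ 2 <= (F (-1) - F 1) * (z - y).
  move=> y1 yz z1; apply: (@le_trans _ _ ((P z - P y) * (z - y))).
    apply: (@sqr_increment_le P (fun y => g1 y ^+ 2) g g1) => //.
    - by move=> x xyz; apply: derive_cont (dP _ _); lra.
    - by move=> x xyz; apply: cg; lra.
    - by move=> x xyz; apply: dP; lra.
    - by move=> x xyz; apply: dg; lra.
  apply: ler_wpM2r; first by rewrite subr_ge0 ltW.
  have := Pl y; have := Pr z; lra.
pose D := F (-1) - F 1.
have cD y z : -1 <= y <= 1 -> {for y, continuous (fun y => D * (z - y) - (g z - g y) ^+ 2)}.
  move=> yI; apply: continuousB.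
    apply: continuousM; first exact: cst_continuous.
    by apply: continuousB; [exact: cst_continuous|exact: id].
  apply: (@continuousM _ _ (fun y => g z - g y) (fun y => g z - g y)).
  - by apply: continuousB; [exact: cst_continuous|exact: cg].
  - by apply: continuousB; [exact: cst_continuous|exact: cg].
have cD' y z : -1 <= z <= 1 -> {for z, continuous (fun z => D * (z - y) - (g z - g y) ^+ 2)}.
  move=> yI; apply: continuousB.
    apply: continuousM; first exact: cst_continuous.
    by apply: continuousB; [exact: id|exact: cst_continuous].
  apply: (@continuousM _ _ (fun z => g z - g y) (fun z => g z - g y)).
  - by apply: continuousB; [exact: cg|exact: cst_continuous].
  - by apply: continuousB; [exact: cg|exact: cst_continuous].
have mainl y z : -1 <= y -> y < z -> z < 1 -> (g z - g y) ^+ 2 <= D * (z - y).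
  move=> y1 yz z1; rewrite -subr_ge0.
  apply: (ge0_left_end yz (cD y z _)); first lra.
  by move=> w wI; rewrite subr_ge0; apply: main; lra.
move=> y z y1 yz z1; rewrite -subr_ge0.
apply: (ge0_right_end yz (cD' y z _)); first lra.
by move=> w wI; rewrite subr_ge0; apply: mainl; lra.
Qed.

End OneDim.

(** * The critical height of a vertical line *)

Section Crit.
Context {R : realType}.
(** Without an interior zero [p] has a constant sign, and [eta] is the wall towards which [|p|]
    decreases: 1 if [p] is negative, -1 if it is positive. The lower bound on the slope then gives
    the same linear bound as at a true zero. *)
Lemma critical_height (p dp : R -> R) :
  (forall y : R, -1 < y < 1 -> is_derive y 1 p (dp y)) ->
  (forall y : R, -1 < y < 1 -> 1 / 2 <= dp y) ->
  exists eta : R, [/\ -1 <= eta <= 1,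
    (forall y : R, -1 < y < 1 -> `|y - eta| / 2 <= `|p y|) &
    (-1 < eta < 1 /\ p eta = 0) \/ eta = -1 \/ eta = 1].
Proof.
move=> pd dp2.
have grow y z : -1 < y -> y <= z -> z < 1 -> (z - y) / 2 <= p z - p y.
  move=> y1; rewrite le_eqVlt => /predU1P[->|yz z1]; first by rewrite !subrr mul0r.
  have [||c cI ->] := mean_value yz (f := p) (df := dp).
  - by move=> x xI; apply: pd; lra.
  - by move=> x xI; apply: derive_cont (pd _ _); lra.
  have h : 1 / 2 <= dp c by apply: dp2; lra.
  have : 0 <= (dp c - 1 / 2) * (z - y) by apply: mulr_ge0; lra.
  by lra.
have [[eta etaI e0]|no] := pselect (exists2 eta, -1 < eta < 1 & p eta = 0).
  exists eta; split; [lra| |by left] => y yI.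
  have [h|h] := leP y eta.
  - have := grow y eta; rewrite e0 => g.
    have -> : `|y - eta| = eta - y by rewrite ler0_norm ?opprB// subr_le0.
    by rewrite ler0_norm; lra.
  - have := grow eta y; rewrite e0 => g.
    have -> : `|y - eta| = y - eta by rewrite ger0_norm// subr_ge0 ltW.
    by rewrite ger0_norm; lra.
have sgn y z : -1 < y < 1 -> -1 < z < 1 -> p y < 0 -> 0 < p z -> False.
  move=> yI zI py pz.
  have yz : y <= z.
    rewrite leNgt; apply/negP => zy; have := grow z y; lra.
  have [||c cI c0] := @IVT _ p y z 0 yz.
  - by apply: continuous_within_segment => x xI; apply: derive_cont (pd _ _); lra.
  - by rewrite ge_min le_max (ltW py) (ltW pz) orbT.
  by apply: no; exists c => //; move: cI; rewrite in_itv /=; lra.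
have pn0 y : -1 < y < 1 -> p y != 0.
  by move=> yI; apply/eqP => y0; apply: no; exists y.
have [[y0 y0I py0]|neg] := pselect (exists2 y, -1 < y < 1 & p y < 0).
  have neg y : -1 < y < 1 -> p y < 0.
    move=> yI; have := pn0 _ yI; rewrite neq_lt => /orP[//|py].
    by case: (sgn y0 y).
  exists 1; split; [lra| |by right; right] => y yI.
  (* For [z] close to 1, negativity of [p z] and the slope bound between [y] and [z] give
     [(z - y) / 2 <= - p y]. *)
  have h : (1 - y) / 2 <= - p y.
    apply/ler_addgt0Pr => e e0.
    pose z := 1 - Num.min e (1 - y) / 2.
    have m0 : 0 < Num.min e (1 - y) by rewrite lt_min e0; lra.
    have m1 : Num.min e (1 - y) <= e by rewrite ge_min lexx.
    have m2 : Num.min e (1 - y) <= 1 - y by rewrite ge_min lexx orbT.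
    have zI : -1 < z < 1 by rewrite /z; lra.
    have := neg z zI; have := grow y z; rewrite /z; lra.
  have -> : `|y - 1| = 1 - y by rewrite ler0_norm ?opprB//; lra.
  by rewrite ler0_norm; have := neg _ yI; lra.
have pos y : -1 < y < 1 -> 0 < p y.
  move=> yI; have := pn0 _ yI; rewrite neq_lt => /orP[py|//].
  by case: neg; exists y.
exists (-1); split; [lra| |by right; left] => y yI.
have h : (1 + y) / 2 <= p y.
  apply/ler_addgt0Pr => e e0.
  pose z := -1 + Num.min e (1 + y) / 2.
  have m0 : 0 < Num.min e (1 + y) by rewrite lt_min e0; lra.
  have m1 : Num.min e (1 + y) <= e by rewrite ge_min lexx.
  have m2 : Num.min e (1 + y) <= 1 + y by rewrite ge_min lexx orbT.
  have zI : -1 < z < 1 by rewrite /z; lra.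
  have := pos z zI; have := grow z y; rewrite /z; lra.
have -> : `|y - -1| = 1 + y by rewrite ger0_norm; lra.
by rewrite ger0_norm; have := pos _ yI; lra.
Qed.

End Crit.

(** * Maximum principles on the strip *)

Section MaximumPrinciple.
Context {R : realType}.
Implicit Types (u ux uxx uy uyy v vx vxx vy vyy : R -> R -> R).

(** Exactly what comparison arguments need: joint continuity of [u] for the existence of maxima, and
    pure second derivatives along each axis. Mixed derivatives never occur. *)
Definition strip_C2 u ux uxx uy uyy : Prop :=
  [/\ continuous (fun z : R * R => u z.1 z.2),
      forall y, -1 < y < 1 -> C2on setT (u^~ y) (ux^~ y) (uxx^~ y) &
      forall x, C2on [set y | -1 < y < 1] (u x) (uy x) (uyy x)].

Lemma continuous2_comp (T : topologicalType) u (f g : T -> R) t :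
  continuous (fun z : R * R => u z.1 z.2) ->
  {for t, continuous f} -> {for t, continuous g} ->
  {for t, continuous (fun t => u (f t) (g t))}.
Proof.
by move=> cu cf cg; apply: (@continuous2_cvg _ _ _ _ _ _ f g u);
  [exact: cu (f t, g t)|exact: cf|exact: cg].
Qed.

Lemma strip_C2_slice u ux uxx uy uyy x : strip_C2 u ux uxx uy uyy ->
  continuous (u x).
Proof.
move=> [cu _ _] y.
by apply: (continuous2_comp cu); [exact: cst_continuous|exact: id].
Qed.

Lemma strip_C2_scale k u ux uxx uy uyy : strip_C2 u ux uxx uy uyy ->
  strip_C2 (fun x y => k * u x y) (fun x y => k * ux x y)
    (fun x y => k * uxx x y) (fun x y => k * uy x y) (fun x y => k * uyy x y).
Proof.
move=> [cu xu yu]; split.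
- by move=> z; apply: continuousM; [exact: cst_continuous|exact: cu].
- by move=> y yI; apply: C2on_scale; exact: xu.
- by move=> x; apply: C2on_scale; exact: yu.
Qed.

Lemma strip_C2_sub u ux uxx uy uyy v vx vxx vy vyy :
  strip_C2 u ux uxx uy uyy -> strip_C2 v vx vxx vy vyy ->
  strip_C2 (fun x y => u x y - v x y) (fun x y => ux x y - vx x y)
    (fun x y => uxx x y - vxx x y) (fun x y => uy x y - vy x y)
    (fun x y => uyy x y - vyy x y).
Proof.
move=> [cu xu yu] [cv xv yv]; split.
- by move=> z; apply: continuousB; [exact: cu|exact: cv].
- by move=> y yI; apply: C2on_sub; [exact: xu|exact: xv].
- by move=> x; apply: C2on_sub; [exact: yu|exact: yv].
Qed.

Lemma strip_C2_shift h u ux uxx uy uyy : strip_C2 u ux uxx uy uyy ->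
  strip_C2 (fun x y => u (x + h) y) (fun x y => ux (x + h) y)
    (fun x y => uxx (x + h) y) (fun x y => uy (x + h) y)
    (fun x y => uyy (x + h) y).
Proof.
move=> [cu xu yu]; split.
- move=> [x y]; apply: (continuous2_comp cu); last exact: cvg_snd.
  apply: (@continuousD _ _ _ fst (cst h)); [exact: cvg_fst|exact: cst_continuous].
- by move=> y yI; exact: (@C2on_shift _ (u^~ y) (ux^~ y) (uxx^~ y) h (xu y yI)).
- by move=> x; exact: yu.
Qed.

Lemma strip_C2_quad k0 k1 k2 : strip_C2 (fun x _ => k0 + k1 * x + k2 * x ^+ 2)
  (fun x _ => k1 + 2 * k2 * x) (fun _ _ => 2 * k2) (fun _ _ => 0) (fun _ _ => 0).
Proof.
split.
- move=> [x y]; apply: (@continuous_comp _ _ _ fst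
    (fun x : R => k0 + k1 * x + k2 * x ^+ 2)); first exact: cvg_fst.
  have [d _ _] := @C2on_quad R setT k0 k1 k2 x I.
  exact: derive_cont d.
- by move=> y _; exact: C2on_quad.
- by move=> x; exact: C2on_cst.
Qed.

(** Comparison with a parabola in y that is nonnegative between the walls and whose Laplacian is
    slightly below [- F]. *)
Lemma rectangle_max u ux uxx uy uyy F M a b : strip_C2 u ux uxx uy uyy ->
  a < b -> 0 <= F -> 0 <= M ->
  (forall x y, a < x < b -> -1 < y < 1 -> - (uxx x y + uyy x y) <= F) ->
  (forall x, u x (-1) <= 0 /\ u x 1 <= 0) ->
  (forall y, -1 <= y <= 1 -> u a y <= M /\ u b y <= M) ->
  forall x y, a <= x <= b -> -1 <= y <= 1 -> u x y <= M + F / 2 * (1 - y ^+ 2).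
Proof.
move=> uC2 ab F0 M0 lap uy0 uab x y xab yI.
apply/ler_addgt0Pr => e e0.
have [cu xu yu] := uC2.
(* At an interior maximum of [v] one gets [- (uxx + uyy) >= G], which contradicts [lap] because [G]
   is larger than [F]. The excess costs [e * (1 - y ^+ 2)], at most [e]. *)
pose G := F + 2 * e.
pose v x y := u x y - (M + G / 2 + 0 * y + (- (G / 2)) * y ^+ 2).
suff : v x y <= 0.
  have : 0 <= e * y ^+ 2 by apply: mulr_ge0; [exact: ltW|exact: sqr_ge0].
  by rewrite /v /G; lra.
have cK : compact (`[a, b] `*` `[-1, 1] : set (R * R)).
  by apply: compact_setX; exact: segment_compact.
have K0 : (`[a, b] `*` `[-1, 1] : set (R * R)) !=set0.
  by exists (x, y); split => /=; rewrite in_itv.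
have cv : continuous (fun z : R * R => v z.1 z.2).
  move=> [x1 y1]; rewrite /v; apply: cvgB; first exact: cu.
  apply: (@continuous_comp _ _ _ snd
    (fun x : R => M + G / 2 + 0 * x + (- (G / 2)) * x ^+ 2)); first exact: cvg_snd.
  have [d _ _] := @C2on_quad R setT (M + G / 2) 0 (- (G / 2)) y1 I.
  exact: derive_cont d.
have [[p q]] := compact_EVT_max K0 cK (continuous_subspaceT cv).
rewrite inE => -[/=]; rewrite !in_itv /= => pab qI vmax.
have {}vmax x1 y1 : a <= x1 <= b -> -1 <= y1 <= 1 -> v x1 y1 <= v p q.
  by move=> h1 h2; apply: (vmax (x1, y1)); rewrite inE; split; rewrite /= in_itv.
apply: le_trans (vmax _ _ xab yI) _.
rewrite leNgt; apply/negP => v0.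
have q2 : 0 <= G / 2 * (1 - q ^+ 2).
  apply: mulr_ge0; first by rewrite /G; lra.
  have : 0 <= (1 - q) * (1 + q) by apply: mulr_ge0; lra.
  by lra.
have [pa pb] : p != a /\ p != b.
  by split; apply/eqP => pE; have := uab q qI; move: v0; rewrite /v pE; lra.
have [q0 q1] : q != -1 /\ q != 1.
  split; apply/eqP => qE; have := uy0 p; move: v0; rewrite /v qE;
    by rewrite ?sqrrN expr1n; lra.
have pab' : a < p < b by move: pab; rewrite !le_eqVlt eq_sym (negbTE pa) (negbTE pb).
have qI' : -1 < q < 1 by move: qI; rewrite !le_eqVlt eq_sym (negbTE q0) (negbTE q1).
have h1 : uxx p q <= 0.
  have m0 : 0 < Num.min (p - a) (b - p) by rewrite lt_min; lra.
  have m1 : Num.min (p - a) (b - p) <= p - a by rewrite ge_min lexx.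
  have m2 : Num.min (p - a) (b - p) <= b - p by rewrite ge_min lexx orbT.
  apply: (second_derivative_max m0 _ (xu q qI')) => // w.
  rewrite ltr_norml => h; have := @vmax w q _ qI.
  by rewrite /v => /(_ ltac:(lra)); lra.
have h2 : uyy p q - 2 * (- (G / 2)) <= 0.
  have m0 : 0 < Num.min (q + 1) (1 - q) by rewrite lt_min; lra.
  have m1 : Num.min (q + 1) (1 - q) <= q + 1 by rewrite ge_min lexx.
  have m2 : Num.min (q + 1) (1 - q) <= 1 - q by rewrite ge_min lexx orbT.
  apply: (second_derivative_max m0 _ (C2on_sub (yu p) (@C2on_quad R _ (M + G / 2) 0 (- (G / 2))))).
    by move=> w; rewrite ltr_norml /=; lra.
  by move=> w; rewrite ltr_norml => h; apply: (@vmax p w pab); lra.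
have := lap p q pab' qI'; move: h2; rewrite /G; lra.
Qed.

End MaximumPrinciple.

(** * Bounded functions on the whole strip, and doubling of variables *)

Section MaximumPrinciple2.
Context {R : realType}.
Implicit Types (u ux uxx uy uyy v vx vxx vy vyy : R -> R -> R).

(** A Phragmen-Lindelof argument: subtracting [e * (z - x) ^+ 2] makes the function nonpositive on
    distant lateral sides, changes the Laplacian by [2 * e] only, and costs nothing at [x]
    itself. *)
Lemma bounded_strip_max u ux uxx uy uyy F B : strip_C2 u ux uxx uy uyy ->
  0 <= F ->
  (forall x y, -1 < y < 1 -> - (uxx x y + uyy x y) <= F) ->
  (forall x, u x (-1) <= 0 /\ u x 1 <= 0) ->
  (forall x y, -1 <= y <= 1 -> u x y <= B) ->
  forall x y, -1 <= y <= 1 -> u x y <= F / 2 * (1 - y ^+ 2).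
Proof.
move=> uC2 F0 lap u0 uB x y yI; apply/ler_addgt0Pr => e e0.
(* Since [N] is at least 1, [e * N ^+ 2 >= e * N >= B]: the penalty dominates [u] on the lateral
   sides. *)
pose N := Num.max 1 (B / e).
have N1 : 1 <= N by rewrite le_max lexx.
have NB : B <= e * N ^+ 2.
  have h : B <= e * N by rewrite mulrC -ler_pdivrMr// le_max lexx orbT.
  apply: (le_trans h); rewrite ler_pM2l// expr2 ler_peMl//; lra.
have vC2 := strip_C2_sub uC2 (strip_C2_quad (e * x ^+ 2) (- 2 * e * x) e).
have N2 : 0 <= N ^+ 2 by exact: sqr_ge0.
have vE z w : u z w - (e * x ^+ 2 + - 2 * e * x * z + e * z ^+ 2) =
    u z w - e * (z - x) ^+ 2 by ring.
have := rectangle_max vC2 (F := F + 2 * e) (M := 0) (a := x - N) (b := x + N).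
move=> /(_ ltac:(lra) ltac:(lra) ltac:(lra)).
have y2 : 0 <= (1 - y) * (1 + y) by apply: mulr_ge0; lra.
have y20 : 0 <= y ^+ 2 by exact: sqr_ge0.
have ey2 : 0 <= e * y ^+ 2 by apply: mulr_ge0; lra.
suff side : [/\ (forall z w, x - N < z < x + N -> -1 < w < 1 ->
      - (uxx z w - 2 * e + (uyy z w - 0)) <= F + 2 * e),
    (forall z, u z (-1) - (e * x ^+ 2 + - 2 * e * x * z + e * z ^+ 2) <= 0 /\
      u z 1 - (e * x ^+ 2 + - 2 * e * x * z + e * z ^+ 2) <= 0) &
    (forall w, -1 <= w <= 1 ->
      u (x - N) w - (e * x ^+ 2 + - 2 * e * x * (x - N) + e * (x - N) ^+ 2) <= 0 /\
      u (x + N) w - (e * x ^+ 2 + - 2 * e * x * (x + N) + e * (x + N) ^+ 2) <= 0)].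
  case: side => s1 s2 s3 /(_ s1 s2 s3 x y ltac:(lra) yI).
  by rewrite vE subrr expr0n /= mulr0; lra.
split.
- by move=> z w _ wI; have := lap z w wI; lra.
- move=> z; rewrite !vE; have [z1 z2] := u0 z.
  have : 0 <= e * (z - x) ^+ 2 by apply: mulr_ge0; [lra|exact: sqr_ge0].
  by lra.
- move=> w wI; rewrite !vE; have h1 := uB (x - N) w wI; have h2 := uB (x + N) w wI.
  have -> : (x - N - x) ^+ 2 = N ^+ 2 by ring.
  have -> : (x + N - x) ^+ 2 = N ^+ 2 by ring.
  by lra.
Qed.

(* Brandt's doubling of variables: the difference u p y - u q y satisfies an
   elliptic equation in the three variables p, q, y and vanishes on p = q. *)
Lemma increment_le u ux uxx uy uyy F : strip_C2 u ux uxx uy uyy -> 0 < F ->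
  (forall x y, -1 < y < 1 -> `|uxx x y + uyy x y| <= F) ->
  (forall x, u x (-1) = 0 /\ u x 1 = 0) ->
  (forall x y, -1 <= y <= 1 -> `|u x y| <= F / 2) ->
  forall p t y, 0 <= t <= 1 -> -1 <= y <= 1 ->
  u p y - u (p - t) y <= 2 * F * t.
Proof.
move=> uC2 F0 lap u0 uF x0 t0 y0 t0I y0I; apply/ler_addgt0Pr => e' e'0.
pose e := Num.min e' (F / 2).
have ee' : e <= e' by rewrite ge_min lexx.
have eF : e <= F / 2 by rewrite ge_min lexx orbT.
have e0 : 0 < e by rewrite lt_min e'0; lra.
have [cu xu yu] := uC2.
pose N := Num.max 1 (F / e).
have N1 : 1 <= N by rewrite le_max lexx.
have NB : F <= e * N ^+ 2.
  have h : F <= e * N by rewrite mulrC -ler_pdivrMr// le_max lexx orbT.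
  apply: (le_trans h); rewrite ler_pM2l// expr2 ler_peMl//; lra.
(* The first part is concave in [t], vanishes at [t = 0] like the increment, and equals [F] at
   [t = 1], where the increment is at most [F]. The second part confines the maximum in [p]. *)
pose b (p t : R) := (2 * F * t - F * t ^+ 2) + e * (p - x0) ^+ 2.
pose v p t y := u p y - u (p - t) y - b p t.
suff : v x0 t0 y0 <= 0.
  have : 0 <= F * t0 ^+ 2 by apply: mulr_ge0; [lra|exact: sqr_ge0].
  by rewrite /v /b subrr expr0n /= mulr0; lra.
pose K := (`[x0 - N, x0 + N] `*` `[0, 1]) `*` `[-1, 1] : set ((R * R) * R).
have cK : compact K.
  by apply: compact_setX; [apply: compact_setX|]; exact: segment_compact.
have K0 : K !=set0.
  by exists ((x0, t0), y0); split; [split|]; rewrite /= in_itv /=; lra.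
have cv : continuous (fun z : (R * R) * R => v z.1.1 z.1.2 z.2).
  move=> [[p t] y].
  have c1 : {for ((p, t), y), continuous (fun z : (R * R) * R => z.1.1)}.
    by apply: (@continuous_comp _ _ _ fst fst); exact: cvg_fst.
  have c2 : {for ((p, t), y), continuous (fun z : (R * R) * R => z.1.2)}.
    by apply: (@continuous_comp _ _ _ fst snd); [exact: cvg_fst|exact: cvg_snd].
  have c3 : {for ((p, t), y), continuous (fun z : (R * R) * R => z.2)}.
    exact: cvg_snd.
  have c4 : {for ((p, t), y), continuous (fun z : (R * R) * R => z.1.1 - x0)}.
    by apply: cvgB => //; exact: cvg_cst.
  rewrite /v /b; apply: cvgB.
    apply: cvgB; apply: (continuous2_comp cu) => //.
    exact: cvgB.
  apply: cvgD; first apply: cvgB.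
  - by apply: cvgM => //; exact: cvg_cst.
  - apply: cvgM; first exact: cvg_cst.
    exact: (cvgM c2 c2).
  - apply: cvgM; first exact: cvg_cst.
    exact: (cvgM c4 c4).
have [[[p t] y]] := compact_EVT_max K0 cK (continuous_subspaceT cv).
rewrite inE => -[[/=]]; rewrite !in_itv /= => pI tI yI vmax.
have {}vmax x1 t1 y1 : x0 - N <= x1 <= x0 + N -> 0 <= t1 <= 1 ->
    -1 <= y1 <= 1 -> v x1 t1 y1 <= v p t y.
  move=> h1 h2 h3; apply: (vmax ((x1, t1), y1)); rewrite inE.
  by split; [split|]; rewrite /= in_itv.
apply: (@le_trans _ _ (v p t y)); first by apply: vmax => //; lra.
rewrite leNgt; apply/negP => v0.
have px2 : 0 <= e * (p - x0) ^+ 2 by apply: mulr_ge0; [lra|exact: sqr_ge0].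
have B0 : 0 <= 2 * F * t - F * t ^+ 2.
  have : 0 <= F * (t * (2 - t)) by apply: mulr_ge0; [lra|apply: mulr_ge0; lra].
  by lra.
have u1 := uF p y yI; have u2 := uF (p - t) y yI.
have uu : u p y - u (p - t) y <= F.
  by move: u1 u2; rewrite !ler_norml; lra.
have t_neq0 : t != 0.
  by apply/eqP => tE; move: v0 px2; rewrite /v /b tE subr0 subrr expr0n /=; lra.
have t_neq1 : t != 1.
  by apply/eqP => tE; move: v0 px2; rewrite /v /b; move: uu; rewrite tE expr1n; lra.
have [y_neq0 y_neq1] : y != -1 /\ y != 1.
  by split; apply/eqP => yE; have [r1 r2] := u0 p; have [r3 r4] := u0 (p - t);
    move: v0; rewrite /v yE ?r1 ?r2 ?r3 ?r4 /b; lra.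
have [p_neq0 p_neq1] : p != x0 - N /\ p != x0 + N.
  split; apply/eqP => pE; move: v0; rewrite /v /b; have : (p - x0) ^+ 2 = N ^+ 2.
  - by rewrite pE; ring.
  - by move=> ->; lra.
  - by rewrite pE; ring.
  - by move=> ->; lra.
have pI' : x0 - N < p < x0 + N.
  by move: pI; rewrite !le_eqVlt eq_sym (negbTE p_neq0) (negbTE p_neq1).
have tI' : 0 < t < 1.
  by move: tI; rewrite !le_eqVlt eq_sym (negbTE t_neq0) (negbTE t_neq1).
have yI' : -1 < y < 1.
  by move: yI; rewrite !le_eqVlt eq_sym (negbTE y_neq0) (negbTE y_neq1).
pose r := Num.min (Num.min (p - (x0 - N)) (x0 + N - p))
  (Num.min (Num.min t (1 - t)) (Num.min (y + 1) (1 - y))).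
have r0 : 0 < r by rewrite !lt_min; lra.
have [r1 r2 r3 [r4 r5 r6]] : [/\ r <= p - (x0 - N), r <= x0 + N - p, r <= t &
    [/\ r <= 1 - t, r <= y + 1 & r <= 1 - y]].
  by rewrite /r !ge_min !lexx !orbT.
clearbody r.
clear v0 px2 B0 u1 u2 uu NB N1 pI' tI' t0I y0I ee' e'0.
(* In the independent variables [p], [q], [y] the second derivatives at the maximum give [uxx p y +
   uyy p y - (uxx q y + uyy q y) <= 2 * e - 4 * F], whereas [lap] bounds the left side below by
   [- 2 * F]. This is impossible as [e <= F / 2]. *)
pose q := p - t.
have h1 : uxx p y - 2 * (e - F) <= 0.
  have := C2on_sub (xu y yI') (@C2on_quad R setT
    (u q y - 2 * F * q - F * q ^+ 2 + e * x0 ^+ 2) (2 * F + 2 * F * q - 2 * e * x0) (e - F)).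
  move/second_derivative_max => /(_ p r r0); apply => // w.
  rewrite ltr_norml => wr.
  have := @vmax w (w - q) y; rewrite /v /b /q /=.
  have -> : w - (w - (p - t)) = p - t by ring.
  by move=> /(_ ltac:(lra) ltac:(lra) yI); lra.
have h2 : - 1 * uxx q y - 2 * (- F) <= 0.
  have := C2on_sub (C2on_scale (- 1) (xu y yI')) (@C2on_quad R setT
    (- u p y + 2 * F * p - F * p ^+ 2 + e * (p - x0) ^+ 2) (- 2 * F + 2 * F * p) (- F)).
  move/second_derivative_max => /(_ q r r0); apply => // w.
  rewrite ltr_norml => wr.
  have := @vmax p (p - w) y pI; rewrite /v /b /q /=.
  have -> : p - (p - w) = w by ring.
  by move: wr; rewrite /q => wr /(_ ltac:(lra) yI); lra.
have h3 : uyy p y - uyy q y <= 0.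
  have := C2on_sub (yu p) (yu q).
  move/second_derivative_max => /(_ y r r0); apply.
    by move=> w; rewrite ltr_norml /=; lra.
  move=> w; rewrite ltr_norml => wr.
  by have := @vmax p t w pI tI; rewrite /v /q /= => /(_ ltac:(lra)); lra.
have := lap p y yI'; have := lap q y yI'; rewrite !ler_norml.
by lra.
Qed.

End MaximumPrinciple2.

(** * Integrals over a vertical line *)

Section SliceIntegral.
Context {R : realType}.
Implicit Types (f g k : R -> R) (a b : R).

Lemma integrable_segment k a b : continuous k ->
  (@lebesgue_measure R).-integrable `[a, b] (EFin \o k).
Proof.
move=> ck; apply: continuous_compact_integrable; first exact: segment_compact.
exact: continuous_subspaceT.
Qed.

Lemma primitive k a b : continuous k -> a < b ->
  exists2 J : R -> R, (forall y, a <= y <= b -> is_derive y 1 J (k y)) &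
    J b - J a = (\int[lebesgue_measure]_(y in `[a, b]) k y).
Proof.
move=> ck ab.
(* Integrating from [a - 1] makes [a] an interior point, so that [J] has two-sided derivatives on
   all of the closed segment. *)
pose J (y : R) := (\int[lebesgue_measure]_(t in `[a - 1, y]) k t).
have dJ y : a <= y <= b -> is_derive y 1 J (k y).
  move=> yI; have [] := @continuous_FTC1_closed R k (a - 1) y (b + 1).
  - by lra.
  - exact: integrable_segment.
  - by lra.
  - exact: ck.
  by move=> d e; split; [exact: d|rewrite -derive1E].
exists J => //.
have := @continuous_FTC2 R k J a b ab (continuous_subspaceT ck).
rewrite /Rintegral => -> //.
- have cJ y : a <= y <= b -> {for y, continuous J} by move=> yI; apply: derive_cont (dJ _ yI).
  split.
  + by move=> y; rewrite in_itv /= => yI; have [] := dJ y; first lra.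
  + by apply: cvg_at_right_filter; apply: cJ; lra.
  + by apply: cvg_at_left_filter; apply: cJ; lra.
- move=> y; rewrite in_itv /= => yI; have [|_ e] := dJ y; first lra.
  by rewrite derive1E.
Qed.

Definition slice_int k : R := (\int[lebesgue_measure]_(y in `[-1, 1]) k y).

Lemma slice_int_le f g : continuous f -> continuous g ->
  (forall y, -1 <= y <= 1 -> f y <= g y) -> slice_int f <= slice_int g.
Proof.
move=> cf cg fg; apply: le_Rintegral => //; exact: integrable_segment.
Qed.

Lemma slice_intD f g : continuous f -> continuous g ->
  slice_int (fun y => f y + g y) = slice_int f + slice_int g.
Proof. by move=> cf cg; apply: RintegralD => //; exact: integrable_segment. Qed.

Lemma slice_intZ c f : continuous f ->
  slice_int (fun y => c * f y) = c * slice_int f.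
Proof. by move=> cf; apply: RintegralZl => //; exact: integrable_segment. Qed.

Lemma slice_int_cst (c : R) : slice_int (fun=> c) = 2 * c.
Proof.
rewrite /slice_int Rintegral_cst//= lebesgue_measure_itv /= lte_fin.
by rewrite ifT; [rewrite /= ; ring|lra].
Qed.

Lemma slice_int_limit (k_ : nat -> R -> R) k B c :
  (forall n, continuous (k_ n)) -> continuous k ->
  (forall n y, -1 <= y <= 1 -> `|k_ n y| <= B) ->
  (forall y, -1 <= y <= 1 -> k_ ^~ y @ \oo --> k y) ->
  (forall n, slice_int (k_ n) <= c) -> slice_int k <= c.
Proof.
move=> ck_ ck kB kk kc.
have [||||||i1 _ cv] := @dominated_convergence _ _ R lebesgue_measure
  (`[-1, 1]%classic : set R) _ (fun n => EFin \o k_ n) (EFin \o k) (EFin \o cst B).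
- exact: measurable_itv.
- move=> n; apply/measurable_EFinP; apply: measurable_funTS.
  exact: continuous_measurable_fun.
- apply/measurable_EFinP; apply: measurable_funTS.
  exact: continuous_measurable_fun.
- apply: aeW => y /=; rewrite in_itv /= => yI; apply: cvg_EFin.
    by apply: nearW.
  exact: kk.
- by apply: integrable_segment; exact: cst_continuous.
- by apply: aeW => y n /=; rewrite in_itv /= => yI; rewrite lee_fin kB.
have : (\int[lebesgue_measure]_(y in `[(-1)%R, 1%R]) (k y)%:E <= c%:E)%E.
  apply: (cvge_le _ cv); apply: nearW => n /=.
  rewrite -[leLHS]fineK ?lee_fin; first exact: kc.
  by apply: integrable_fin_num => //; exact: integrable_segment.
move=> h; rewrite -lee_fin fineK//.
by apply: integrable_fin_num => //; exact: integrable_segment.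
Qed.

Lemma slice_int_sqr_eq0 k : continuous k -> slice_int (fun y => k y ^+ 2) <= 0 ->
  forall y, -1 < y < 1 -> k y = 0.
Proof.
move=> ck k0 y yI; apply/eqP; rewrite -[_ == _]negbK; apply/negP => ky.
have ck2 : continuous (fun y => k y ^+ 2) by move=> z; apply: (@continuousM _ _ k k); exact: ck.
have [J dJ JE] := primitive ck2 (a := -1) (b := 1) ltac:(lra).
have cJ z : -1 <= z <= 1 -> {for z, continuous J} by move=> zI; apply: derive_cont (dJ _ zI).
have Jmono a b : -1 <= a -> a <= b -> b <= 1 -> J a <= J b.
  move=> a1 ab b1; apply: (derive_ge0_le (df := fun y => k y ^+ 2) ab).
  - by move=> z zI; apply: cJ; lra.
  - by move=> z zI; apply: dJ; lra.
  - by move=> z _; exact: sqr_ge0.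
have k2 : 0 < k y ^+ 2 by rewrite exprn_even_gt0.
have [r r0 hr] := cont_near k2 (ck2 y).
pose m := Num.min r (1 - y) / 2.
have m0 : 0 < Num.min r (1 - y) by rewrite lt_min r0; lra.
have m1 : Num.min r (1 - y) <= r by rewrite ge_min lexx.
have m2 : Num.min r (1 - y) <= 1 - y by rewrite ge_min lexx orbT.
have ym : y < y + m by rewrite /m; lra.
have [||xi xiI e] := mean_value ym (f := J) (df := fun y => k y ^+ 2).
- by move=> z zI; apply: dJ; move: zI; rewrite /m; lra.
- by move=> z zI; apply: cJ; move: zI; rewrite /m; lra.
have : 0 < k xi ^+ 2 * (y + m - y).
  apply: mulr_gt0; last by rewrite /m; lra.
  have /hr : `|xi - y| < r by move: xiI; rewrite ltr_norml /m; lra.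
  by rewrite ltr_norml; lra.
have h1 : J (-1) <= J y by apply: Jmono; lra.
have h2 : J (y + m) <= J 1 by apply: Jmono; rewrite ?/m; lra.
move: k0; rewrite /slice_int -JE -e; lra.
Qed.

End SliceIntegral.

(** * Singular majorants and continuity up to the walls *)

Section SliceBounds.
Context {R : realType}.
Implicit Types (f g k b : R -> R) (al eta A B : R).

(** The odd power centred at [eta]: a primitive of [al * |y - eta| ^ (al - 1)] away from [eta], and
    continuous across [eta] when [0 < al]. *)
Definition signed_powR al eta (y : R) : R :=
  if y < eta then - ((eta - y) `^ al) else (y - eta) `^ al.

Lemma norm_signed_powR al eta y : `|signed_powR al eta y| = `|y - eta| `^ al.
Proof.
rewrite /signed_powR; case: ifPn => [h|].
  by rewrite normrN ger0_norm ?powR_ge0// ltr0_norm ?opprB// subr_lt0.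
by rewrite -leNgt => h; rewrite !ger0_norm ?powR_ge0// subr_ge0.
Qed.

Lemma is_derive_signed_powR al eta y : y != eta ->
  is_derive y 1 (signed_powR al eta) (al * `|y - eta| `^ (al - 1)).
Proof.
rewrite neq_lt => /orP[h|h].
  have d1 : is_derive y 1 (fun z : R => - z + eta) (- 1).
    by apply: is_derive_eq; ring.
  have h' : 0 < - y + eta by rewrite addrC subr_gt0.
  have d2 := is_derive1_powR al h'.
  have d3 := @is_derive1_comp R (fun z : R => z `^ al) (fun z : R => - z + eta) y _ _ d2 d1.
  have d4 := is_deriveN d3.
  rewrite distrC gtr0_norm ?subr_gt0//.
  apply: (@near_eq_is_derive _ _ _ (- ((fun z : R => z `^ al) \o (fun z => - z + eta)))).
    near=> z; rewrite /signed_powR ifT; first by rewrite /= [eta - z]addrC.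
    near: z; exact: lt_nbhsl.
  by apply: is_derive_eq; rewrite mulrN1 opprK [eta - y]addrC.
have d1 : is_derive y 1 (fun z : R => z - eta) 1.
  by apply: is_derive_eq; ring.
have h' : 0 < y - eta by rewrite subr_gt0.
have d2 := is_derive1_powR al h'.
have d3 := @is_derive1_comp R (fun z : R => z `^ al) (fun z : R => z - eta) y _ _ d2 d1.
rewrite gtr0_norm ?subr_gt0//.
apply: (@near_eq_is_derive _ _ _ ((fun z : R => z `^ al) \o (fun z => z - eta))).
  near=> z; rewrite /signed_powR ifF//.
  apply/negbTE; rewrite -leNgt ltW//.
  near: z; exact: lt_nbhsr.
by apply: is_derive_eq; rewrite mulr1.
Unshelve. all: by end_near. Qed.

Lemma continuous_signed_powR al eta : 0 < al -> continuous (signed_powR al eta).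
Proof.
move=> al0 y; have [->|h] := eqVneq y eta; last first.
  exact: derive_cont (is_derive_signed_powR al h).
apply/cvgrPdist_lt => e e0.
have s0 : signed_powR al eta eta = 0.
  by rewrite /signed_powR ltxx subrr powR0// gt_eqF.
have r0 : 0 < e `^ al^-1 by exact: powR_gt0.
have -> : e = (e `^ al^-1) `^ al by rewrite -powRrM mulVf ?gt_eqF// powRr1 ?ltW.
have : \forall z \near eta, `|eta - z| < e `^ al^-1 by exact: (nbhsx_ballx eta _ r0).
apply: filterS => z hz; rewrite distrC s0 subr0 norm_signed_powR distrC.
by apply: gt0_ltr_powR => //; rewrite ?nnegrE ?normr_ge0// (ltW r0).
Qed.

(* The bound is integrable in spite of the singularity at eta, as 0 < al; the
   comparison is made between primitives. *)
Lemma slice_int_singular_le k al eta A B : continuous k -> 0 < al ->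
  -1 <= eta <= 1 -> 0 <= B ->
  (forall y, -1 < y < 1 -> y != eta -> k y <= A + B * `|y - eta| `^ (al - 1)) ->
  slice_int k <= 2 * A + 2 * B * (2 `^ al / al).
Proof.
move=> ck al0 etaI B0 kle.
have [J dJ JE] := primitive ck (a := -1) (b := 1) ltac:(lra).
pose G y := A * y + B / al * signed_powR al eta y - J y.
have dG y : -1 < y < 1 -> y != eta ->
    is_derive y 1 G (A + B * `|y - eta| `^ (al - 1) - k y).
  move=> yI ye; have d1 := is_derive_signed_powR al ye.
  have d2 : is_derive y 1 J (k y) by apply: dJ; lra.
  apply: is_derive_eq; rewrite /GRing.scale /= !mulr1.
  by rewrite mulrA divfK ?gt_eqF// mulr0 ?addr0 ?add0r; ring.
have : G (-1) <= G 1.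
  apply: (derive_ge0_le_except (df := fun y => A + B * `|y - eta| `^ (al - 1) - k y) (c := eta)).
  - by lra.
  - move=> x xI; apply: continuousB; first apply: continuousD.
    + by apply: continuousM; [exact: cst_continuous|exact: id].
    + by apply: continuousM; [exact: cst_continuous|exact: continuous_signed_powR].
    + exact: derive_cont (dJ _ xI).
  - by move=> x xI xe; rewrite subr_ge0; exact: kle.
have pb y : -1 <= y <= 1 -> `|signed_powR al eta y| <= 2 `^ al.
  move=> yI; rewrite norm_signed_powR; apply: ge0_ler_powR => //.
  - exact: ltW.
  - by rewrite nnegrE.
  - by rewrite ler_norml; lra.
have b1 : signed_powR al eta 1 <= 2 `^ al.
  by apply: le_trans (ler_norm _) _; apply: pb; lra.
have b2 : - signed_powR al eta (-1) <= 2 `^ al.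
  rewrite (le_trans (ler_norm _))// normrN; apply: pb; lra.
have Bal : 0 <= B / al by rewrite divr_ge0// ltW.
have : B / al * (signed_powR al eta 1 - signed_powR al eta (-1)) <=
    B / al * (2 `^ al + 2 `^ al).
  by apply: ler_wpM2l => //; lra.
rewrite /slice_int -JE /G.
have -> : 2 * B * (2 `^ al / al) = B / al * (2 `^ al + 2 `^ al) by ring.
by lra.
Qed.

(** Derivatives of psi are known in the open strip only; a majorant that vanishes at the walls
    forces the limit 0 there. *)
Lemma continuous_zero_extension g b : continuous b ->
  (forall y : R, -1 < y < 1 -> {for y, continuous g}) ->
  (forall y, -1 < y < 1 -> `|g y| <= b y) ->
  (forall y, ~~ (-1 < y < 1) -> b y = 0) ->
  continuous (fun y : R => if -1 < y < 1 then g y else 0).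
Proof.
move=> cb cg gb b0 y.
have [yI|yI] := boolP (-1 < y < 1).
  have near_in : \forall z \near y, -1 < z < 1.
    have /andP[y1 y2] := yI; near=> z; apply/andP; split; near: z.
    - exact: lt_nbhsr.
    - exact: lt_nbhsl.
  rewrite /prop_for /continuous_at yI.
  apply: cvg_trans (cg _ yI); apply: near_eq_cvg.
  by near=> z; rewrite ifT//; near: z.
apply/cvgrPdist_lt => e e0; rewrite (negbTE yI).
have := cb y; rewrite /continuous_at (b0 _ yI) => /cvgrPdist_lt /(_ _ e0).
apply: filterS => z; rewrite !sub0r !normrN.
case: ifPn => [zI|_ _]; last by rewrite normr0.
by move=> h; apply: le_lt_trans (gb _ zI) _; apply: le_lt_trans (ler_norm _) h.
Unshelve. all: by end_near. Qed.

End SliceBounds.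

(** * The energy argument *)

Section Core.
Context {R : realType}.
(* u is psi, extended by 0 outside the strip, and w is omega; the suffixes x, y
   denote partial derivatives, with irrelevant values outside the open strip. *)
Context (al eps c : R) (u ux uxx uy uyy w wx wy : R -> R -> R).
Context (al_gt0 : 0 < al).
Context (eps_gt0 : 0 < eps).
Context (uC2 : strip_C2 u ux uxx uy uyy).
Context (u_out : forall x y : R, ~~ (-1 < y < 1) -> u x y = 0).
Context (poisson : forall x y : R, -1 < y < 1 -> - (uxx x y + uyy x y) = w x y).
Context (ux_cont : forall x y : R, -1 < y < 1 -> {for y, continuous (ux x)}).
Context (uxx_cont : forall x y : R, -1 < y < 1 -> {for y, continuous (uxx x)}).
Context (w_cont : forall x, continuous (w x)).
Context (w_le : forall x y : R, -1 < y < 1 -> `|w x y| <= eps).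
Context (dw : forall x y : R, -1 < y < 1 -> is_derive x 1 (w^~ y) (wx x y)).
Context (wx_le : forall x y : R, -1 < y < 1 -> `|wx x y| <= eps).
Context (wy_le : forall x y : R, -1 < y < 1 -> `|wy x y| <= eps).
Context (wx_holder : forall x z y : R, -1 < y < 1 ->
  `|wx x y - wx z y| <= eps * `|x - z| `^ al).
Context (wy_holder : forall x y z : R, -1 < y < 1 -> -1 < z < 1 ->
  `|wy x y - wy x z| <= eps * `|y - z| `^ al).
Context (transport : forall x y : R, -1 < y < 1 ->
  (y - c + uy x y) * wx x y = ux x y * wy x y).
Context (decay : forall N m : R, 0 < m ->
  (exists2 a, N < a & forall y, `|u a y| <= m) /\
  (exists2 a, a < N & forall y, `|u a y| <= m)).

(** The lines given by [decay] on the two sides of [x] bound a rectangle on whose lateral sides [v]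
    is at most [e]. *)
Lemma decaying_strip_max v vx vxx vy vyy F : strip_C2 v vx vxx vy vyy ->
  0 <= F ->
  (forall x y, -1 < y < 1 -> - (vxx x y + vyy x y) <= F) ->
  (forall x y, v x y <= `|u x y|) ->
  forall x y, -1 <= y <= 1 -> v x y <= F / 2 * (1 - y ^+ 2).
Proof.
move=> vC2 F0 lap vu x y yI; apply/ler_addgt0Pr => e e0.
have [[b xb hb] [a ax ha]] := decay x e0.
rewrite addrC; apply: (rectangle_max vC2 (a := a) (b := b)) => //.
- exact: lt_trans ax xb.
- exact: ltW.
- by move=> z t _; exact: lap.
- by move=> z; split; rewrite (le_trans (vu _ _))// u_out ?normr0//; lra.
- by move=> z _; split; rewrite (le_trans (vu _ _)).
- by rewrite !ltW.
Qed.

Lemma u_le x y : -1 <= y <= 1 -> `|u x y| <= eps / 2 * (1 - y ^+ 2).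
Proof.
move=> yI; rewrite ler_norml; apply/andP; split.
- rewrite lerNl -mulN1r.
  apply: (decaying_strip_max (strip_C2_scale (- 1) uC2)) => //; first exact: ltW.
  + move=> z t tI; have := w_le z tI; rewrite -poisson// ler_norml; lra.
  + by move=> z t; rewrite mulN1r -normrN ler_norm.
- apply: (decaying_strip_max uC2) => //; first exact: ltW.
  + by move=> z t tI; rewrite poisson//; apply: le_trans (ler_norm _) (w_le _ tI).
  + by move=> z t; exact: ler_norm.
Qed.

(* phi h replaces ux, whose second derivatives need not exist. *)
Definition phi h x y := h^-1 * (u (x + h) y - u x y).
Definition phix h x y := h^-1 * (ux (x + h) y - ux x y).
Definition phixx h x y := h^-1 * (uxx (x + h) y - uxx x y).
Definition phiy h x y := h^-1 * (uy (x + h) y - uy x y).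
Definition phiyy h x y := h^-1 * (uyy (x + h) y - uyy x y).
Definition dqw h x y := h^-1 * (w (x + h) y - w x y).

Lemma phiC2 h : strip_C2 (phi h) (phix h) (phixx h) (phiy h) (phiyy h).
Proof. exact: strip_C2_scale (strip_C2_sub (strip_C2_shift h uC2) uC2). Qed.

Lemma phi_poisson h x y : -1 < y < 1 ->
  phixx h x y + phiyy h x y = - dqw h x y.
Proof. by move=> yI; rewrite /phixx /phiyy /dqw -!poisson//; ring. Qed.

Lemma phi_out h x y : ~~ (-1 < y < 1) -> phi h x y = 0.
Proof. by move=> yI; rewrite /phi !u_out// subrr mulr0. Qed.

Lemma phi_bd h x : phi h x (-1) = 0 /\ phi h x 1 = 0.
Proof. by split; apply: phi_out; lra. Qed.

Lemma quotientE (f df : R -> R) (h x : R) : 0 < h ->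
  (forall z : R, is_derive z 1 f (df z)) ->
  exists2 xi, x < xi < x + h & h^-1 * (f (x + h) - f x) = df xi.
Proof.
move=> h0 d; have xh : x < x + h by rewrite ltrDl.
have [xi xiI ->] := mean_value xh (fun z _ => d z)
  (fun z _ => derive_cont (d z)).
by exists xi => //; rewrite addrAC subrr add0r mulrC mulfK// gt_eqF.
Qed.

Lemma dqwE h x y : 0 < h -> -1 < y < 1 ->
  exists2 xi, x < xi < x + h & dqw h x y = wx xi y.
Proof. move=> h0 yI.
exact: (@quotientE (w^~ y) (wx^~ y) h x h0 (fun z => dw z yI)). Qed.

Lemma dqw_le h x y : 0 < h -> -1 < y < 1 -> `|dqw h x y| <= eps.
Proof. by move=> h0 yI; have [xi _ ->] := dqwE x h0 yI; exact: wx_le. Qed.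

Lemma dqw_wx h x y : 0 < h -> -1 < y < 1 ->
  `|dqw h x y - wx x y| <= eps * h `^ al.
Proof.
move=> h0 yI; have [xi xiI ->] := dqwE x h0 yI.
apply: le_trans (wx_holder _ _ yI) _; apply: ler_wpM2l; first exact: ltW.
apply: ge0_ler_powR; rewrite ?nnegrE//; try exact: ltW.
by rewrite ler_norml; lra.
Qed.

(** The crude bound [h^-1 * eps] serves only to apply [bounded_strip_max], whose conclusion does not
    depend on it; hence an estimate uniform in [h]. *)
Lemma phi_le h x y : 0 < h -> -1 <= y <= 1 ->
  `|phi h x y| <= eps / 2 * (1 - y ^+ 2).
Proof.
move=> h0 yI.
have e0 := ltW eps_gt0.
have B z t : -1 <= t <= 1 -> `|phi h z t| <= h^-1 * eps.
  move=> tI; rewrite /phi normrM gtr0_norm ?invr_gt0//.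
  apply: ler_wpM2l; first by rewrite invr_ge0 ltW.
  have t2 : 0 <= eps * t ^+ 2 by rewrite mulr_ge0// sqr_ge0.
  have := u_le (z + h) tI; have := u_le z tI; rewrite !ler_norml; lra.
rewrite ler_norml; apply/andP; split.
- rewrite lerNl -mulN1r.
  apply: (bounded_strip_max (strip_C2_scale (- 1) (phiC2 h)) e0 (B := h^-1 * eps)) => //.
  + move=> z t tI; have := dqw_le z h0 tI; have := phi_poisson h z tI.
    by rewrite ler_norml; lra.
  + by move=> z; have [-> ->] := phi_bd h z; rewrite mulr0.
  + by move=> z t tI; have := B z t tI; rewrite ler_norml; lra.
- apply: (bounded_strip_max (phiC2 h) e0 (B := h^-1 * eps)) => //.
  + move=> z t tI; have := dqw_le z h0 tI; have := phi_poisson h z tI.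
    by rewrite ler_norml; lra.
  + by move=> z; have [-> ->] := phi_bd h z.
  + by move=> z t tI; have := B z t tI; rewrite ler_norml; lra.
Qed.

Lemma phi_le_half h x y : 0 < h -> -1 <= y <= 1 -> `|phi h x y| <= eps / 2.
Proof.
move=> h0 yI; apply: le_trans (phi_le x h0 yI) _.
have : 0 <= eps * y ^+ 2 by rewrite mulr_ge0 ?sqr_ge0// ltW.
by lra.
Qed.

Lemma phi_increment h x t y : 0 < h -> 0 <= t <= 1 -> -1 <= y <= 1 ->
  `|phi h x y - phi h (x - t) y| <= 2 * eps * t.
Proof.
move=> h0 tI yI; rewrite ler_norml; apply/andP; split.
- have := increment_le (strip_C2_scale (- 1) (phiC2 h)) eps_gt0 _ _ _ x tI yI.
  set P := (X in _ <= X) => H; rewrite /P.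
  suff : -1 * phi h x y - -1 * phi h (x - t) y <= 2 * eps * t by lra.
  apply: H.
  + move=> z s sI; have := dqw_le z h0 sI; have := phi_poisson h z sI.
    by rewrite !ler_norml; lra.
  + by move=> z; have [-> ->] := phi_bd h z; rewrite mulr0.
  + by move=> z s sI; rewrite normrM normrN1 mul1r; exact: phi_le_half.
- apply: (increment_le (phiC2 h) eps_gt0 _ _ _ x tI yI).
  + move=> z s sI; have := dqw_le z h0 sI; have := phi_poisson h z sI.
    by rewrite !ler_norml; lra.
  + by move=> z; have [-> ->] := phi_bd h z.
  + by move=> z s sI; exact: phi_le_half.
Qed.

(** With the translation equal to the step [s] of the difference quotient, the increment of [phi s]
    is [s^-1] times a centred second difference of [u], that is [s * uxx xi y]. Continuity of [uxx]
    in x then carries the bound from [xi] to [x]. *)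
Lemma uxx_le x y : -1 < y < 1 -> `|uxx x y| <= 2 * eps.
Proof.
move=> yI; rewrite -subr_ge0.
have [cu xu yu] := uC2.
have cxx : {for x, continuous (fun z => 2 * eps - `|uxx z y|)}.
  have [_ _ cc] := xu y yI x I.
  apply: continuousB; first exact: cst_continuous.
  exact: (continuous_comp cc (@norm_continuous _ _ _)).
rewrite leNgt; apply/negP => neg.
have [|r r0 hr] := cont_near _ cxx (e := - (2 * eps - `|uxx x y|)).
  by rewrite oppr_gt0.
pose s := Num.min r 1 / 2.
have m0 : 0 < Num.min r 1 by rewrite lt_min r0 ltr01.
have m1 : Num.min r 1 <= r by rewrite ge_min lexx.
have m2 : Num.min r 1 <= 1 by rewrite ge_min lexx orbT.
have s0 : 0 < s by rewrite /s; lra.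
have [z _|z _|xi xiI e] := @second_difference R (u^~ y) (ux^~ y) (uxx^~ y) x s s0.
- by have [] := xu y yI z I.
- by have [] := xu y yI z I.
have sI : 0 <= s <= 1 by rewrite /s; lra.
have yI' : -1 <= y <= 1 by lra.
have := phi_increment x s0 sI yI'.
rewrite /phi subrK.
have -> : s^-1 * (u (x + s) y - u x y) - s^-1 * (u x y - u (x - s) y) =
    s * uxx xi y.
  transitivity (s^-1 * (u (x + s) y + u (x - s) y - 2 * u x y)); first by ring.
  by rewrite e expr2 -mulrA mulKf// gt_eqF.
rewrite normrM gtr0_norm// mulrC ler_pM2r// => h.
have /hr : `|xi - x| < r by move: xiI; rewrite !ltr_norml /s; lra.
rewrite ltr_norml; lra.
Qed.

Lemma ux_lip x z y : -1 < y < 1 -> `|ux x y - ux z y| <= 2 * eps * `|x - z|.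
Proof.
move=> yI; wlog xz : x z / z <= x => [hw|].
  by have [/hw//|/ltW/hw] := leP z x; rewrite distrC [`|z - x|]distrC.
have [cu xu yu] := uC2.
have [||xi _ ->] := @MVT_segment R (ux^~ y) (uxx^~ y) z x xz.
- by move=> t _; have [] := xu y yI t I.
- apply: continuous_within_segment => t _; have [_ d _] := xu y yI t I.
  exact: derive_cont d.
by rewrite normrM ler_wpM2r// uxx_le.
Qed.

Lemma phi_ux h x y : 0 < h -> -1 < y < 1 -> `|phi h x y - ux x y| <= 2 * eps * h.
Proof.
move=> h0 yI; have [cu xu yu] := uC2.
have [|xi xiI] := @quotientE (u^~ y) (ux^~ y) h x h0.
  by move=> z; have [] := xu y yI z I.
rewrite -/(phi h x y) => ->; apply: le_trans (ux_lip _ _ yI) _.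
apply: ler_wpM2l; first by rewrite mulr_ge0// ltW.
by rewrite ler_norml; lra.
Qed.

Lemma phi_lip h x z y : 0 < h -> `|phi h x y - phi h z y| <= 2 * eps * `|x - z|.
Proof.
move=> h0; have [yI|yI] := boolP (-1 < y < 1); last first.
  by rewrite !phi_out// subrr normr0 !mulr_ge0// ltW.
wlog xz : x z / z <= x => [hw|].
  by have [/hw//|/ltW/hw] := leP z x; rewrite distrC [`|z - x|]distrC.
have [cu xu yu] := phiC2 h.
have [||xi _ ->] := @MVT_segment R ((phi h)^~ y) ((phix h)^~ y) z x xz.
- by move=> t _; have [] := xu y yI t I.
- apply: continuous_within_segment => t _; have [d _ _] := xu y yI t I.
  exact: derive_cont d.
rewrite normrM ler_wpM2r// /phix normrM gtr0_norm ?invr_gt0//.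
rewrite ler_pdivrMl// mulrC (le_trans (ux_lip _ _ yI))//.
by rewrite addrAC subrr add0r gtr0_norm.
Qed.

(** Not uniform in [h]; it serves at a fixed step, for continuity at the walls and for dominated
    convergence. *)
Lemma phixx_le h x y : 0 < h -> -1 < y < 1 -> `|phixx h x y| <= 4 * eps / h.
Proof.
move=> h0 yI; rewrite /phixx normrM gtr0_norm ?invr_gt0// mulrC.
apply: ler_wpM2r; first by rewrite invr_ge0 ltW.
by have := uxx_le (x + h) yI; have := uxx_le x yI; rewrite !ler_norml; lra.
Qed.

Lemma phi_slice_cont h x : continuous (phi h x).
Proof. exact: strip_C2_slice (phiC2 h). Qed.

(** Nothing is known of [phixx] at the walls, but it is bounded and [phi] tends to 0 there. *)
Lemma phi_phixx_cont h x : 0 < h ->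
  continuous (fun y => phi h x y * phixx h x y).
Proof.
move=> h0; have cphi := @phi_slice_cont h x.
have -> : (fun y => phi h x y * phixx h x y) =
    (fun y => if -1 < y < 1 then phi h x y * phixx h x y else 0).
  by apply/funext => y; case: ifPn => // /phi_out ->; rewrite mul0r.
apply: (@continuous_zero_extension _ _ (fun y => 4 * eps / h * `|phi h x y|)).
- move=> y; apply: (@continuousM _ _ (cst (4 * eps / h)) (fun y => `|phi h x y|)).
    exact: cst_continuous.
  exact: (continuous_comp (cphi y) (@norm_continuous _ _ _)).
- move=> y yI; apply: (@continuousM _ _ (phi h x) (phixx h x)); first exact: cphi.
  apply: (@continuousM _ _ (cst h^-1) (fun y => uxx (x + h) y - uxx x y)).
    exact: cst_continuous.
  by apply: continuousB; exact: uxx_cont.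
- move=> y yI; rewrite normrM mulrC ler_wpM2r//; exact: phixx_le.
- by move=> y /phi_out ->; rewrite normr0 mulr0.
Qed.

Lemma phi_dqw_cont h x : continuous (fun y => phi h x y * dqw h x y).
Proof.
move=> y; apply: (@continuousM _ _ (phi h x) (dqw h x)).
  exact: phi_slice_cont.
apply: (@continuousM _ _ (cst h^-1) (fun y => w (x + h) y - w x y)).
  exact: cst_continuous.
by apply: continuousB; exact: w_cont.
Qed.

(** * The estimate on one vertical line. The bound 1/6 gives the slope 1/2 of y - c + psi_y; the
    second bound lets the Dirichlet energy be absorbed *)

Context (eps_le : eps <= 1 / 6)
  (eps_le_al : eps * (10 + 12 * (2 `^ al / al)) <= 1 / 2).

(* In the next two lemmas g, q, s, v stand for phi h, wx, ux, wy at (x, y), p for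
   y - c + uy x y, t for the distance to the point eta where p vanishes, D for
   the Dirichlet energy of the slice of phi h, and rho bounds phi h - ux. Here
   wy vanishes at eta, and T is t `^ (al - 1). *)
Lemma regular_point_bound (g q p s v t T D rho : R) : 0 < t -> 0 <= T ->
  0 <= rho -> t / 2 <= `|p| -> p * q = s * v -> `|v| <= eps * (t * T) ->
  `|s| <= `|g| + rho -> g ^+ 2 <= 2 * D ->
  `|q * g| <= eps * (6 * D + rho ^+ 2) * T.
Proof.
move=> t0 T0 rho0 tp pq vt sg gD.
have g0 := normr_ge0 g.
have h1 : `|q| * t <= 2 * eps * T * (`|g| + rho) * t.
  have : `|q| * (t / 2) <= `|q| * `|p| by apply: ler_wpM2l.
  rewrite [`|q| * `|p|]mulrC -normrM pq normrM => h.
  have : `|s| * `|v| <= (`|g| + rho) * (eps * (t * T)) by apply: ler_pM.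
  by lra.
rewrite ler_pM2r// in h1.
have h2 : (`|g| + rho) * `|g| <= (6 * D + rho ^+ 2) / 2.
  have gg : `|g| ^+ 2 <= 2 * D by rewrite -normrX ger0_norm ?sqr_ge0.
  have : 0 <= (`|g| - rho) ^+ 2 by exact: sqr_ge0.
  by move: gg; rewrite !expr2; lra.
rewrite normrM; apply: (@le_trans _ _ (2 * eps * T * (`|g| + rho) * `|g|)).
  exact: ler_wpM2r.
have eT : 0 <= 2 * eps * T by rewrite !mulr_ge0// ltW.
have := ler_wpM2l eT h2; lra.
Qed.

(* Here ux vanishes at eta, so that the value g0 of phi h there is small. *)
Lemma critical_point_bound (g g0 q p s v t D rho : R) : 0 < t ->
  0 <= rho -> 0 <= D -> t / 2 <= `|p| -> p * q = s * v -> `|v| <= eps -> `|q| <= eps ->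
  `|s| <= `|g| + rho -> `|g0| <= rho -> (g - g0) ^+ 2 <= D * t ->
  `|q * g| <= eps * (5 * D + 7 * rho).
Proof.
move=> t0 rho0 D0 tp pq vle qle sg g0le gD.
have e0 := ltW eps_gt0.
pose a := `|g - g0|.
have a0 : 0 <= a by exact: normr_ge0.
have aD : a ^+ 2 <= D * t by rewrite /a -normrX ger0_norm ?sqr_ge0.
have ga : `|g| <= a + rho.
  by rewrite -[g](subrK g0) (le_trans (ler_normD _ _))// lerD.
have gn := normr_ge0 g.
have h1 : `|q| * t <= 2 * eps * (a + 2 * rho).
  have : `|q| * (t / 2) <= `|q| * `|p| by apply: ler_wpM2l.
  rewrite [`|q| * `|p|]mulrC -normrM pq normrM => h.
  have : `|s| * `|v| <= (`|g| + rho) * eps by apply: ler_pM.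
  have : (`|g| + rho) * eps <= (a + 2 * rho) * eps by apply: ler_wpM2r => //; lra.
  by lra.
(* Within distance [rho] of eta the equation is not divided by [t]: [|q| <= eps] and
   [a ^+ 2 <= D * rho] suffice. Farther away [rho ^+ 2 <= rho * t], so division by [t] leaves only a
   multiple of [rho]. *)
rewrite normrM; have [tr|rt] := leP t rho.
- apply: (@le_trans _ _ (eps * (a + rho))); first exact: ler_pM.
  apply: ler_wpM2l => //.
  have aDr : a ^+ 2 <= D * rho by apply: le_trans aD _; apply: ler_wpM2l.
  suff : a <= D + rho by lra.
  rewrite -(@ler_pXn2r _ 2) ?nnegrE//; last lra.
  apply: (le_trans aDr).
  have : 0 <= D * rho by rewrite mulr_ge0.
  have : 0 <= D ^+ 2 by exact: sqr_ge0.
  have : 0 <= rho ^+ 2 by exact: sqr_ge0.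
  by rewrite sqrrD; lra.
- rewrite -(ler_pM2r t0).
  apply: (@le_trans _ _ (2 * eps * (a + 2 * rho) * (a + rho))).
    by rewrite mulrAC; apply: ler_pM => //; rewrite mulr_ge0// ltW.
  have : (a + 2 * rho) * (a + rho) <= (5 * D * t + 7 * rho * t) / 2.
    have r2 : rho ^+ 2 <= rho * t by rewrite expr2; apply: ler_wpM2l => //; exact: ltW.
    have : 0 <= (a - rho) ^+ 2 by exact: sqr_ge0.
    by rewrite sqrrB; lra.
  have ee : 0 <= 2 * eps by lra.
  by move/(ler_wpM2l ee); lra.
Qed.

(** The integral of [phi * phixx] is the only part of the energy identity not controlled on the line
    itself; at an approximate maximum of the energy it is at most a small [d]. *)
Lemma slice_energy_le h x d : 0 < h <= 1 ->
  slice_int (fun y => phi h x y * phixx h x y) <= d ->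
  slice_int (fun y => phi h x y ^+ 2) <= 8 * d + 32 * h + 16 * h `^ al.
Proof.
move=> /andP[h0 h1] kd.
have e0 := ltW eps_gt0; have eps6 := eps_le.
have [cphi xphi yphi] := phiC2 h.
set g := phi h x.
have cg : continuous g := @phi_slice_cont h x.
have ck : continuous (fun y => phi h x y * dqw h x y + phi h x y * phixx h x y).
  by move=> y; apply: (@continuousD _ _ _ (fun y => phi h x y * dqw h x y)
    (fun y => phi h x y * phixx h x y)); [exact: phi_dqw_cont|exact: phi_phixx_cont].
(* By [phi_poisson] the integrand is [- phi * phiyy], so [- J] is the antiderivative required by
   [dirichlet_energy] and [D] is the Dirichlet energy of the slice. *)
have [J dJ JE] := primitive ck (a := -1) (b := 1) ltac:(lra).
set D := J 1 - J (-1) in JE.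
have DE : D = slice_int (fun y => phi h x y * dqw h x y) +
    slice_int (fun y => phi h x y * phixx h x y).
  rewrite JE -slice_intD//; [exact: phi_dqw_cont|exact: phi_phixx_cont].
have [gN1 g1] := phi_bd h x.
have cJ (t : R) : -1 <= t <= 1 -> {for t, continuous (fun y => - J y)}.
  by move=> tI; apply: continuousN; exact: derive_cont (dJ _ tI).
have dNJ (t : R) : -1 < t < 1 ->
    is_derive t 1 (fun y => - J y) (g t * phiyy h x t).
  move=> tI; have dJt := dJ t ltac:(lra); apply: is_derive_eq.
  have -> : phiyy h x t = - dqw h x t - phixx h x t.
    by have := phi_poisson h x tI; lra.
  by rewrite /g; ring.
have dg (t : R) : -1 < t < 1 -> is_derive t 1 g (phiy h x t).
  by move=> tI; have [] := yphi x t tI.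
have dg1 (t : R) : -1 < t < 1 -> is_derive t 1 (phiy h x) (phiyy h x t).
  by move=> tI; have [] := yphi x t tI.
have energy y z : -1 <= y -> y < z -> z <= 1 -> (g z - g y) ^+ 2 <= D * (z - y).
  move=> y1 yz z1; have := dirichlet_energy (fun t _ => cg t) cJ gN1 g1 dg dg1 dNJ
    y1 yz z1.
  by rewrite /D opprK [- _ + _]addrC.
clearbody D.
have D0 : 0 <= D.
  have := energy (-1) 1; rewrite /g gN1 g1 subrr expr0n /=.
  by move=> /(_ ltac:(lra) ltac:(lra) ltac:(lra)); lra.
have g2D y : -1 <= y <= 1 -> g y ^+ 2 <= 2 * D.
  move=> /andP[]; rewrite le_eqVlt => /predU1P[<- _|y1 y2].
    by rewrite /g gN1 expr0n /= mulr_ge0.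
  have := energy (-1) y (lexx _) y1 y2; rewrite {2}/g gN1 subr0.
  have : D * (y - -1) <= D * 2 by apply: ler_wpM2l; lra.
  by lra.
have energy' y z : -1 <= y <= 1 -> -1 <= z <= 1 -> y != z ->
    (g y - g z) ^+ 2 <= D * `|y - z|.
  move=> yI zI; rewrite neq_lt => /orP[yz|zy].
    rewrite -sqrrN opprB distrC gtr0_norm ?subr_gt0//; apply: energy; lra.
  by rewrite gtr0_norm ?subr_gt0//; apply: energy; lra.
pose rho := 2 * eps * h.
have rho0 : 0 <= rho by rewrite !mulr_ge0// ltW.
have rho_h : rho <= h.
  have : eps * h <= 1 / 6 * h by rewrite ler_pM2r.
  by rewrite /rho; lra.
have [cu xu yu] := uC2.
have [||eta [etaI heta eta3]] := @critical_height R
    (fun y => y - c + uy x y) (fun y => 1 + uyy x y).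
- move=> y yI; have [_ d2 _] := yu x y yI.
  by apply: is_derive_eq; rewrite subr0.
- move=> y yI /=; have e1 := poisson x yI.
  have := w_le x yI; rewrite ler_norml => /andP[e2 e3].
  have := uxx_le x yI; rewrite ler_norml => /andP[e4 e5].
  by lra.
(* The majorant adds the bounds of the critical and the regular case, so that it holds in either;
   [h ^ al] pays for replacing [dqw] by [wx]. *)
pose A := eps * (5 * D + 7 * rho) + h `^ al.
pose B := eps * (6 * D + rho ^+ 2).
have B0 : 0 <= B.
  by apply: mulr_ge0 => //; apply: addr_ge0; [exact: mulr_ge0|exact: sqr_ge0].
have hal0 : 0 <= h `^ al by exact: powR_ge0.
have bound y : -1 < y < 1 -> y != eta ->
    `|wx x y * g y| <= eps * (5 * D + 7 * rho) + B * `|y - eta| `^ (al - 1).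
  move=> yI ye; have T0 : 0 <= `|y - eta| `^ (al - 1) by exact: powR_ge0.
  have t0 : 0 < `|y - eta| by rewrite normr_gt0 subr_eq0.
  have ug : `|ux x y| <= `|g y| + rho.
    have := phi_ux x h0 yI; rewrite -/g -/rho distrC => hh.
    by rewrite -[ux x y](subrK (g y)) (le_trans (ler_normD _ _))// addrC lerD2l.
  have yI' : -1 <= y <= 1 by lra.
  have regular : `|wy x y| <= eps * `|y - eta| `^ al ->
      `|wx x y * g y| <= B * `|y - eta| `^ (al - 1).
    rewrite -mulr_powRB1// => hv.
    apply: (regular_point_bound t0 T0 rho0 (heta y yI) (transport x yI) hv ug).
    exact: g2D.
  have critical : `|g eta| <= rho -> `|wx x y * g y| <= eps * (5 * D + 7 * rho).
    move=> hg.
    apply: (critical_point_bound t0 rho0 D0 (heta y yI) (transport x yI)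
      (wy_le x yI) (wx_le x yI) ug hg).
    exact: energy'.
  have crit' : `|g eta| <= rho ->
      `|wx x y * g y| <= eps * (5 * D + 7 * rho) + B * `|y - eta| `^ (al - 1).
    by move=> /critical/le_trans; apply; rewrite lerDl mulr_ge0.
  (* At a wall [g] vanishes. At an interior zero the transport equation reads [ux * wy = 0]: either
     [ux] vanishes, so [g] is within [rho] of 0, or [wy] does, and its Hoelder bound applies. *)
  case: eta3 => [[etaI' peta]|eta1]; last first.
    by apply: crit'; case: eta1 => ->; rewrite /g ?gN1 ?g1 normr0.
  have /esym/eqP := transport x etaI'; rewrite peta mul0r mulf_eq0 => /orP[]/eqP ue.
    by apply: crit'; have := phi_ux x h0 etaI'; rewrite ue subr0.
  apply: (@le_trans _ _ (B * `|y - eta| `^ (al - 1))); last first.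
    by rewrite lerDr mulr_ge0//; lra.
  by apply: regular; have := wy_holder x yI etaI'; rewrite ue subr0.
have slice : slice_int (fun y => phi h x y * dqw h x y) <= 2 * A + 2 * B * (2 `^ al / al).
  apply: (slice_int_singular_le (eta := eta)) => //; first exact: phi_dqw_cont.
  move=> y yI ye; have := bound y yI ye.
  have gh : `|g y| <= 1.
    by have := phi_le_half x h0 (y := y); rewrite -/g => /(_ ltac:(lra)); lra.
  have : `|(dqw h x y - wx x y) * g y| <= h `^ al.
    rewrite normrM -[leRHS]mulr1; apply: ler_pM => //.
    apply: (le_trans (dqw_wx x h0 yI)); rewrite ler_piMl//; lra.
  rewrite /A -/g => h2 h3.
  have := ler_norm (wx x y * g y); have := ler_norm ((dqw h x y - wx x y) * g y).
  by lra.
clearbody rho.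
have C0 : 0 <= 2 `^ al / al by rewrite divr_ge0 ?powR_ge0// ltW.
(* The coefficient of [D] on the right is [eps * (10 + 12 * C)], at most 1/2, and is absorbed on the
   left. *)
have D_le : D <= 2 * d + 8 * h + 4 * h `^ al.
  have epsal := eps_le_al.
  set C := 2 `^ al / al in C0 slice epsal *.
  have r1 : rho ^+ 2 <= h.
    rewrite expr2; apply: (le_trans _ rho_h); apply: ler_piMl => //.
    exact: (le_trans rho_h h1).
  have r2 : eps * (14 * rho) <= 14 / 6 * h.
    have : eps * (14 * rho) <= 1 / 6 * (14 * rho) by apply: ler_wpM2r; lra.
    by lra.
  have r3 : eps * C * rho ^+ 2 <= 1 / 24 * h.
    apply: ler_pM => //; [by rewrite mulr_ge0|exact: sqr_ge0|lra].
  have r4 : eps * (10 + 12 * C) * D <= 1 / 2 * D by apply: ler_wpM2r.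
  by move: slice; rewrite /A /B; lra.
have g4 : slice_int (fun y => g y ^+ 2) <= slice_int (fun=> 2 * D).
  apply: slice_int_le => //.
  - by move=> y; apply: (@continuousM _ _ g g); exact: cg.
  - exact: cst_continuous.
by move: g4; rewrite slice_int_cst /g; lra.
Qed.

(** * Approximate maxima of the energy *)

Definition energy h x := slice_int (fun y => phi h x y ^+ 2).

Lemma phi_sqr_cont h x : continuous (fun y => phi h x y ^+ 2).
Proof.
by move=> y; apply: (@continuousM _ _ (phi h x) (phi h x)); exact: phi_slice_cont.
Qed.

Lemma energy_le_energy h x z : 0 < h -> energy h x <= energy h z + `|x - z|.
Proof.
move=> h0; have eps6 := eps_le; have e0 := ltW eps_gt0.
pose d : R := `|x - z| / 2.
have d0 : 0 <= d by rewrite divr_ge0.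
have -> : `|x - z| = slice_int (fun=> d) by rewrite slice_int_cst /d; lra.
have cc : continuous (fun _ : R => d) by move=> y; exact: cst_continuous.
rewrite -slice_intD//; last exact: phi_sqr_cont.
apply: slice_int_le.
- exact: phi_sqr_cont.
- move=> y; apply: (@continuousD _ _ _ (fun y => phi h z y ^+ 2) (cst d)).
    exact: phi_sqr_cont.
  exact: cst_continuous.
move=> y yI; rewrite addrC -lerBlDr subr_sqr.
apply: le_trans (ler_norm _) _; rewrite normrM.
have h1 : `|phi h x y - phi h z y| <= d.
  apply: le_trans (phi_lip x z y h0) _; rewrite /d mulrC.
  by apply: ler_wpM2l => //; lra.
have h2 : `|phi h x y + phi h z y| <= 1.
  apply: le_trans (ler_normD _ _) _.
  by have := phi_le_half x h0 yI; have := phi_le_half z h0 yI; lra.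
by rewrite -[d]mulr1; apply: ler_pM.
Qed.

Lemma energy_cont h : 0 < h -> continuous (energy h).
Proof.
move=> h0 x; apply/cvgrPdist_lt => e e0.
have := nbhsx_ballx x _ e0; apply: filterS => z /= xz.
apply: le_lt_trans xz; rewrite ler_norml.
have := energy_le_energy x z h0; have := energy_le_energy z x h0.
by rewrite [`|z - x|]distrC; lra.
Qed.

Lemma energy_le1 h x : 0 < h -> energy h x <= 1.
Proof.
move=> h0; have eps6 := eps_le; have e0 := ltW eps_gt0.
have -> : 1 = slice_int (fun _ : R => 1 / 2) by rewrite slice_int_cst; lra.
apply: slice_int_le; first exact: phi_sqr_cont.
  by move=> y; exact: cst_continuous.
move=> y yI; rewrite -real_normK ?num_real// expr2.
have p0 := normr_ge0 (phi h x y).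
have hh : `|phi h x y| <= 1 / 2 by have := phi_le_half x h0 yI; lra.
have : `|phi h x y| * `|phi h x y| <= (1 / 2) * 1 by apply: ler_pM => //; lra.
by lra.
Qed.

(** The penalty [d * (x - x0) ^+ 2] exceeds 1, hence the energy, at distance [N], so the penalised
    energy has an interior maximum with energy at least that at [x0]. Second differences are used
    because the energy is only known to be continuous. *)
Lemma energy_max_point h x0 d : 0 < h -> 0 < d ->
  exists2 x, energy h x0 <= energy h x & exists2 r, 0 < r &
    forall s, 0 < s < r ->
      energy h (x + s) + energy h (x - s) - 2 * energy h x <= 2 * d * s ^+ 2.
Proof.
move=> h0 d0; pose N := 1 + d^-1; pose V x := energy h x - d * (x - x0) ^+ 2.
have di0 : 0 < d^-1 by rewrite invr_gt0.
have N0 : 0 < N by rewrite /N; lra.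
have dN : 1 < d * N ^+ 2.
  have -> : d * N ^+ 2 = (d * N) * N by ring.
  have -> : d * N = d + 1 by rewrite /N mulrDr mulr1 divff ?gt_eqF.
  rewrite -[ltLHS]mulr1; apply: ltr_pM => //; rewrite /N; lra.
have cV : continuous V.
  move=> x; apply: (@continuousB _ _ _ (energy h) (fun x => d * (x - x0) ^+ 2)).
    exact: energy_cont.
  apply: (@continuousM _ _ (cst d) (fun x => (x - x0) ^+ 2)); first exact: cst_continuous.
  have cx : {for x, continuous (fun x : R => x - x0)}.
    by apply: continuousB; [exact: id|exact: cst_continuous].
  exact: (continuousM cx cx).
have [||x xI xmax] := @EVT_max R V (x0 - N) (x0 + N).
- by lra.
- exact: continuous_subspaceT.
move: xI; rewrite in_itv /= => xI.
have V0 : V x0 <= V x by apply: xmax; rewrite in_itv /=; lra.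
have Ex0 : energy h x0 = V x0 by rewrite /V subrr expr0n /= mulr0 subr0.
have dx0 : 0 <= d * (x - x0) ^+ 2 by apply: mulr_ge0; [exact: ltW|exact: sqr_ge0].
have E0 : 0 <= energy h x0 by apply: Rintegral_ge0 => y _; exact: sqr_ge0.
have xI' : x0 - N < x < x0 + N.
  have [p1 p2] : x != x0 - N /\ x != x0 + N.
    split; apply/eqP => xE; have : (x - x0) ^+ 2 = N ^+ 2 by rewrite xE; ring.
    - move=> e; move: V0 E0; rewrite -Ex0 /V e; have := energy_le1 x h0; lra.
    - move=> e; move: V0 E0; rewrite -Ex0 /V e; have := energy_le1 x h0; lra.
  by move: xI; rewrite !le_eqVlt eq_sym (negbTE p1) (negbTE p2).
exists x; first by rewrite Ex0; move: V0; rewrite /V; lra.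
pose r := Num.min (x - (x0 - N)) (x0 + N - x).
have r1 : r <= x - (x0 - N) by rewrite ge_min lexx.
have r2 : r <= x0 + N - x by rewrite ge_min lexx orbT.
exists r; first by rewrite /r lt_min; lra.
move=> s /andP[s0 sr].
have := xmax (x + s); have := xmax (x - s); rewrite !in_itv /= /V.
by move=> /(_ ltac:(lra)) + /(_ ltac:(lra)); lra.
Qed.

(** From [b ^+ 2 - a ^+ 2 >= 2 * a * (b - a)] for both neighbours: the discrete form of E'' >= 2
    times the integral of [phi * phixx], where the square of the x-derivative is dropped. *)
Lemma energy_second_difference h x s d : 0 < h -> 0 < s ->
  energy h (x + s) + energy h (x - s) - 2 * energy h x <= 2 * d * s ^+ 2 ->
  slice_int (fun y => s ^- 2 *
    (phi h x y * (phi h (x + s) y + phi h (x - s) y - 2 * phi h x y))) <= d.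
Proof.
move=> h0 s0 hE.
have s2 : 0 < s ^+ 2 by rewrite exprn_gt0.
have cs z := @phi_slice_cont h z.
pose k y := phi h x y * (phi h (x + s) y + phi h (x - s) y - 2 * phi h x y).
have ck : continuous k.
  move=> y; apply: (@continuousM _ _ (phi h x)
    (fun y => phi h (x + s) y + phi h (x - s) y - 2 * phi h x y)); first exact: cs.
  apply: continuousB; first by apply: continuousD; exact: cs.
  by apply: continuousM; [exact: cst_continuous|exact: cs].
rewrite (@slice_intZ R (s ^- 2) k ck) mulrC ler_pdivrMr//.
have c2 : continuous (fun y => 2 * phi h x y ^+ 2).
  move=> y; apply: (@continuousM _ _ (cst 2) (fun y => phi h x y ^+ 2)).
    exact: cst_continuous.
  exact: phi_sqr_cont.
have ck2 : continuous (fun y => 2 * k y).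
  move=> y; apply: (@continuousM _ _ (cst 2) k); [exact: cst_continuous|exact: ck].
have : slice_int (fun y => 2 * k y + 2 * phi h x y ^+ 2) <=
    slice_int (fun y => phi h (x + s) y ^+ 2 + phi h (x - s) y ^+ 2).
  apply: slice_int_le.
  - by move=> y; apply: (@continuousD _ _ _ (fun y => 2 * k y)
      (fun y => 2 * phi h x y ^+ 2)); [exact: ck2|exact: c2].
  - by move=> y; apply: (@continuousD _ _ _ (fun y => phi h (x + s) y ^+ 2)
      (fun y => phi h (x - s) y ^+ 2)); exact: phi_sqr_cont.
  move=> y _; rewrite /k.
  have : 0 <= (phi h (x + s) y - phi h x y) ^+ 2 by exact: sqr_ge0.
  have : 0 <= (phi h (x - s) y - phi h x y) ^+ 2 by exact: sqr_ge0.
  by lra.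
rewrite !slice_intD//; try exact: phi_sqr_cont.
rewrite !slice_intZ//; last exact: phi_sqr_cont.
by move: hE; rewrite /energy; lra.
Qed.

(** The limit of the previous inequality as the spacing [s] tends to 0 with [h] fixed, by dominated
    convergence. *)
Lemma energy_max_point_slice h x d r : 0 < h -> 0 < r ->
  (forall s, 0 < s < r ->
    energy h (x + s) + energy h (x - s) - 2 * energy h x <= 2 * d * s ^+ 2) ->
  slice_int (fun y => phi h x y * phixx h x y) <= d.
Proof.
move=> h0 r0 hE; have eps6 := eps_le; have e0 := ltW eps_gt0.
pose s (n : nat) : R := r / 2 * n.+1%:R^-1.
have s0 n : 0 < s n by rewrite /s !mulr_gt0// ?invr_gt0 ?ltr0n.
have sr n : s n < r.
  have : n.+1%:R^-1 <= (1 : R) by rewrite invf_le1 ?ler1n ?ltr0n.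
  move=> hn; apply: (@le_lt_trans _ _ (r / 2 * 1)); last lra.
  by rewrite /s; apply: ler_wpM2l => //; lra.
have [cphi xphi yphi] := phiC2 h.
have sd n y : -1 < y < 1 -> exists2 xi, `|xi - x| < s n &
    (s n) ^- 2 * (phi h x y * (phi h (x + s n) y + phi h (x - s n) y - 2 * phi h x y)) =
    phi h x y * phixx h xi y.
  move=> yI; have [d1 d2] : (forall u : R, is_derive u 1 ((phi h)^~ y) (phix h u y)) /\
      (forall u : R, is_derive u 1 ((phix h)^~ y) (phixx h u y)).
    by split=> v; have [] := xphi y yI v I.
  have [xi xiI e] := @second_difference R _ _ _ x (s n) (s0 n) (fun v _ => d1 v) (fun v _ => d2 v).
  exists xi => //; rewrite e mulrCA; congr (_ * _); rewrite mulrA mulVf ?mul1r//.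
  by rewrite expf_eq0 /= gt_eqF.
have ph1 y : -1 <= y <= 1 -> `|phi h x y| <= 1.
  by move=> yI; have := phi_le_half x h0 yI; lra.
apply: (@slice_int_limit R (fun n y => (s n) ^- 2 *
   (phi h x y * (phi h (x + s n) y + phi h (x - s n) y - 2 * phi h x y)))
   (fun y => phi h x y * phixx h x y) (4 * eps / h)).
- move=> n y; have cs z := @phi_slice_cont h z.
  apply: (@continuousM _ _ (cst ((s n) ^- 2)) (fun y => phi h x y *
      (phi h (x + s n) y + phi h (x - s n) y - 2 * phi h x y))).
    exact: cst_continuous.
  apply: (@continuousM _ _ (phi h x)
    (fun y => phi h (x + s n) y + phi h (x - s n) y - 2 * phi h x y)); first exact: cs.
  apply: continuousB; first by apply: continuousD; exact: cs.
  by apply: continuousM; [exact: cst_continuous|exact: cs].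
- exact: phi_phixx_cont.
- move=> n y yI; have [yI'|yI'] := boolP (-1 < y < 1); last first.
    by rewrite (phi_out h x yI') mul0r mulr0 normr0 !mulr_ge0 ?invr_ge0// ltW.
  have [xi _ ->] := sd n y yI'.
  rewrite normrM -[leRHS]mul1r; apply: ler_pM => //; first exact: ph1.
  exact: phixx_le.
- move=> y yI; have [yI'|yI'] := boolP (-1 < y < 1); last first.
    rewrite (phi_out h x yI'); under eq_fun do rewrite mul0r mulr0.
    by rewrite mul0r; exact: cvg_cst.
  apply/cvgrPdist_lt => e e'0.
  have [_ _ cxx] := xphi y yI' x I.
  have [q q0 hq] := cont_near e'0 cxx.
  have r20 : 0 < q / r by rewrite divr_gt0.
  have := near_infty_natSinv_lt (PosNum r20); apply: filterS => n /= hn.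
  have [xi xiI ->] := sd n y yI'.
  have /hq : `|xi - x| < q.
    apply: lt_trans xiI _; rewrite /s.
    have : 0 < (n.+1%:R^-1 : R) by rewrite invr_gt0 ltr0n.
    move: hn; move: (n.+1%:R^-1 : R) => v hn v0.
    have h3 : r * v < q by rewrite mulrC -ltr_pdivlMr.
    have h4 : 0 < r * v by rewrite mulr_gt0.
    by lra.
  move=> hx; rewrite -mulrBr normrM [X in _ * X]distrC.
  apply: (@le_lt_trans _ _ (1 * `|phixx h xi y - phixx h x y|)).
    by apply: ler_pM => //; exact: ph1.
  by rewrite mul1r.
- by move=> n; apply: energy_second_difference => //; apply: hE; rewrite s0 sr.
Qed.

Lemma energy_le h x : 0 < h <= 1 -> energy h x <= 32 * h + 16 * h `^ al.
Proof.
move=> hI; have /andP[h0 h1] := hI; apply/ler_addgt0Pr => e e0.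
have d0 : 0 < e / 8 by rewrite divr_gt0.
have [z xz [r r0 hr]] := energy_max_point x h0 d0.
have := slice_energy_le hI (energy_max_point_slice h0 r0 hr).
by move: xz; rewrite /energy; lra.
Qed.

(** * Letting the step tend to 0 *)

Lemma ux_le x y : -1 < y < 1 -> `|ux x y| <= eps / 2 * (1 - y ^+ 2).
Proof.
move=> yI; have eps6 := eps_le; apply/ler_addgt0Pr => e e0.
have yI' : -1 <= y <= 1 by lra.
have h1 := phi_le x e0 yI'; have h2 := phi_ux x e0 yI.
rewrite -[ux x y](subKr (phi e x y)) (le_trans (ler_normB _ _))// lerD//.
by apply: le_trans h2 _; rewrite ler_piMl; lra.
Qed.

Lemma ux_eq0 x y : -1 < y < 1 -> ux x y = 0.
Proof.
move=> yI; have eps6 := eps_le; have e0 := ltW eps_gt0.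
pose q (y : R) := if -1 < y < 1 then ux x y else 0.
have cq : continuous q.
  (* The majorant is [eps / 2] times the positive part of [1 - y ^+ 2]. *)
  apply: (@continuous_zero_extension R _ (fun y : R => eps / 4 * (`|1 - y ^+ 2| + (1 - y ^+ 2)))).
  - move=> t; have c1 : {for t, continuous (fun t : R => 1 - t ^+ 2)}.
      apply: continuousB; first exact: cst_continuous.
      exact: exprn_continuous.
    apply: (@continuousM _ _ (cst (eps / 4)) (fun t : R => `|1 - t ^+ 2| + (1 - t ^+ 2))).
      exact: cst_continuous.
    by apply: continuousD => //; exact: (continuous_comp c1 (@norm_continuous _ _ _)).
  - by move=> t tI; exact: ux_cont.
  - move=> t tI; have t2 : 0 <= (1 - t) * (1 + t) by apply: mulr_ge0; lra.
    have := ux_le x tI.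
    by rewrite [`|1 - t ^+ 2|]ger0_norm; lra.
  - move=> t tI; have t2 : 0 <= t ^+ 2 - 1.
      move: tI; rewrite negb_and -!leNgt => /orP[tI|tI].
        have : 0 <= (- 1 - t) * (1 - t) by apply: mulr_ge0; lra.
        by lra.
      have : 0 <= (t - 1) * (t + 1) by apply: mulr_ge0; lra.
      by lra.
    by rewrite ler0_norm; [rewrite addNr mulr0|lra].
have -> : ux x y = q y by rewrite /q yI.
apply: slice_int_sqr_eq0 => //; apply/ler_addgt0Pr => e e'0; rewrite add0r.
(* Twice the bound of [energy_le] plus [4 * h] is [68 * h + 32 * h ^ al], and each of the two terms
   is made at most [e / 2]. *)
pose h := Num.min 1 (Num.min (e / 136) ((e / 64) `^ al^-1)).
have p0 : 0 < (e / 64) `^ al^-1 by apply: powR_gt0; rewrite divr_gt0.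
have h0 : 0 < h by rewrite !lt_min ltr01 divr_gt0.
have h1 : h <= 1 by rewrite ge_min lexx.
have h2 : h <= e / 136 by rewrite !ge_min lexx !orbT.
have h3 : h <= (e / 64) `^ al^-1 by rewrite !ge_min lexx !orbT.
have h4 : h `^ al <= e / 64.
  have -> : e / 64 = ((e / 64) `^ al^-1) `^ al.
    by rewrite -powRrM mulVf ?gt_eqF// powRr1// divr_ge0// ltW.
  by apply: ge0_ler_powR => //; rewrite ?nnegrE; exact: ltW.
have cphi2 : continuous (fun y => 2 * phi h x y ^+ 2).
  move=> t; apply: (@continuousM _ _ (cst 2) (fun y => phi h x y ^+ 2)).
    exact: cst_continuous.
  exact: phi_sqr_cont.
have : slice_int (fun y => q y ^+ 2) <=
    slice_int (fun y => 2 * phi h x y ^+ 2 + 2 * h).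
  apply: slice_int_le.
  - by move=> t; apply: (@continuousM _ _ q q); exact: cq.
  - move=> t; apply: (@continuousD _ _ _ (fun y => 2 * phi h x y ^+ 2) (cst (2 * h))).
      exact: cphi2.
    exact: cst_continuous.
  move=> t _; rewrite /q; case: ifPn => [tI|/phi_out ->]; last first.
    by rewrite !expr0n /= mulr0 add0r mulr_ge0// ltW.
  have := phi_ux x h0 tI.
  set a := phi h x t; set b := ux x t => ab.
  have ab2 : (a - b) ^+ 2 <= h.
    rewrite -real_normK ?num_real// expr2.
    have n0 := normr_ge0 (a - b).
    have ab1 : `|a - b| <= h by apply: le_trans ab _; rewrite ler_piMl; lra.
    have : `|a - b| * `|a - b| <= h * 1 by apply: ler_pM => //; lra.
    by lra.
  (* This square is [2 * a ^+ 2 + 2 * (a - b) ^+ 2 - b ^+ 2]. *)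
  have : 0 <= (2 * a - b) ^+ 2 by exact: sqr_ge0.
  by move: ab2; rewrite !sqrrB; lra.
rewrite slice_intD//; last by move=> t; exact: cst_continuous.
rewrite slice_intZ; last exact: phi_sqr_cont.
rewrite slice_int_cst.
have hI : 0 < h <= 1 by rewrite h0 h1.
have := energy_le x hI; rewrite /energy; lra.
Qed.

Lemma u_eq0 x y : u x y = 0.
Proof.
have [yI|yI] := boolP (-1 < y < 1); last exact: u_out.
apply/normr0_eq0/eqP; rewrite eq_le normr_ge0 andbT.
apply/ler_addgt0Pr => e e0; rewrite add0r.
have [[a xa ha] _] := decay x e0.
have [cu xu yu] := uC2.
have d (t : R) : is_derive t 1 (u^~ y) (ux t y) by have [] := xu y yI t I.
have [xi _] := mean_value xa (fun t _ => d t) (fun t _ => derive_cont (d t)).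
by rewrite ux_eq0// mul0r => /eqP; rewrite subr_eq0 => /eqP <-.
Qed.

Lemma w_eq0 x y : -1 < y < 1 -> w x y = 0.
Proof.
move=> yI; have [cu xu yu] := uC2.
have m0 : 0 < Num.min (y + 1) (1 - y) by rewrite lt_min; lra.
have m1 : Num.min (y + 1) (1 - y) <= y + 1 by rewrite ge_min lexx.
have m2 : Num.min (y + 1) (1 - y) <= 1 - y by rewrite ge_min lexx orbT.
have yr v : `|v - y| < Num.min (y + 1) (1 - y) -> -1 < v < 1.
  by rewrite ltr_norml; lra.
have h1 : uxx x y <= 0.
  by apply: (second_derivative_max ltr01 _ (xu y yI)) => // v _; rewrite !u_eq0.
have h2 : -1 * uxx x y <= 0.
  by apply: (second_derivative_max ltr01 _ (C2on_scale (-1) (xu y yI))) => // v _;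
    rewrite !u_eq0.
have h3 : uyy x y <= 0.
  by apply: (second_derivative_max m0 yr (yu x)) => // v _; rewrite !u_eq0.
have h4 : -1 * uyy x y <= 0.
  by apply: (second_derivative_max m0 yr (C2on_scale (-1) (yu x))) => // v _;
    rewrite !u_eq0.
by rewrite -poisson//; lra.
Qed.

End Core.

(** * Stream functions and norms *)

Section Slices.
Context {R : realType}.
Local Notation mu := (@lebesgue_measure R).

Lemma measurable_strip_int :
  measurable (strip_int : set (measurableTypeR R * measurableTypeR R)).
Proof.
have -> : (strip_int : set (R * R)) = setT `*` `]-1, 1[%classic.
  by apply/seteqP; split => z; rewrite /strip_int /= in_itv /= => h; [split|case: h].
by apply: measurableX => //; exact: measurable_itv.
Qed.

(** If every line over [A] carried more than [m], Tonelli's theorem would make the integral of the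
    square infinite, as [A] has infinite measure. *)
Lemma L2_small_slice (f : R * R -> R) (A : set R) (m : R) : L2_on strip_int f ->
  measurable (A : set (measurableTypeR R)) -> mu A = +oo%E -> 0 < m ->
  exists2 a, A a &
    (\int[mu]_(y in `](-1)%R, 1%R[) ((f (a, y)) ^+ 2)%:E <= m%:E)%E.
Proof.
move=> [mf nf] mA Aoo m0.
pose F (z : measurableTypeR R * measurableTypeR R) :=
  (`| (EFin \o (f \_ strip_int)) z | `^ 2)%E.
have mfr : measurable_fun setT (f \_ strip_int : measurableTypeR R * measurableTypeR R -> R).
  apply/(measurable_restrict _ measurable_strip_int) => //.
  by rewrite setTI.
have mF : measurable_fun setT F.
  apply: (@measurableT_comp _ _ _ _ _ _ (fun x : \bar R => (x `^ 2)%E)).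
    exact: measurable_poweR.
  by apply: measurableT_comp => //; exact/measurable_EFinP.
have F0 z : (0 <= F z)%E by exact: poweR_ge0.
have intF : (\int[plane_measure]_z F z < +oo)%E.
  move: nf; rewrite /finite_norm unlock /Lnorm.
  by apply: lty_poweRy; rewrite invr_eq0 pnatr_eq0.
have [a Aa ha] : exists2 a, A a & (fubini_F mu F a <= m%:E)%E.
  apply: contrapT => H.
  move: intF; rewrite (fubini_tonelli1 _ mF F0).
  apply/negP; rewrite -leNgt leye_eq -leye_eq.
  have mG : measurable_fun setT (fubini_F mu F) by exact: measurable_fun_fubini_tonelli_F.
  have G0 x : (0 <= fubini_F mu F x)%E by apply: integral_ge0.
  apply: (@le_trans _ _ (\int[mu]_(x in A) fubini_F mu F x)%E); last first.
    by apply: ge0_subset_integral => //; exact: mG.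
  apply: (@le_trans _ _ (\int[mu]_(x in A) (cst m%:E x))%E).
    rewrite integral_cst// [X in (_ * X)%E](_ : _ = +oo%E); last exact: Aoo.
    by rewrite gt0_muley// lte_fin.
  apply: ge0_le_integral => //.
  - by move=> x _; rewrite lee_fin ltW.
  - exact: measurable_funTS.
  move=> x Ax; apply: ltW; rewrite ltNge; apply/negP => h.
  by apply: H; exists x.
exists a => //; apply: le_trans ha; rewrite /fubini_F.
have -> : (\int[mu]_(y in `](-1)%R, 1%R[) (f (a, y) ^+ 2)%:E)%E =
    (\int[mu]_(y in `](-1)%R, 1%R[) F (a, y))%E.
  apply: eq_integral => y; rewrite inE /= in_itv /= => yI.
  rewrite /F /= /patch mem_set//=.
  by rewrite (@powR_mulrn _ _ 2)// real_normK// num_real.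
apply: ge0_subset_integral => //.
by apply: measurableT_comp => //; exact: pair1_measurable.
Qed.

End Slices.

Section Translation.
Context {R : realType}.
Local Notation mu := (@lebesgue_measure R).
Implicit Types (psi omega f : R * R -> R).

Definition clamp (a b y : R) : R := Num.max a (Num.min b y).

Lemma clamp_id a b y : a <= y <= b -> clamp a b y = y.
Proof. by move=> /andP[ay yb]; rewrite /clamp min_r// max_r. Qed.

Lemma clamp_in a b y : a <= b -> a <= clamp a b y <= b.
Proof. by move=> ab; rewrite /clamp le_max lexx ge_max ab ge_min lexx. Qed.

Lemma clamp_continuous a b : continuous (clamp a b).
Proof.
move=> y; apply: (@continuous_max _ _ (cst a) (fun y => Num.min b y)).
  exact: cst_continuous.
by apply: (@continuous_min _ _ (cst b) id); [exact: cst_continuous|exact: id].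
Qed.

(** Cauchy-Schwarz on a segment of length at most 2. As [dg] is continuous in the open segment only,
    the inequality is proved between interior points, with [dg] clamped to them, and then extended
    to -1. *)
Lemma slice_sup_le (g dg : R -> R) (m : R) : continuous g -> g (-1) = 0 -> 0 <= m ->
  (forall y : R, -1 < y < 1 -> is_derive y 1 g (dg y)) ->
  (forall y : R, -1 < y < 1 -> {for y, continuous dg}) ->
  (\int[mu]_(y in `](-1)%R, 1%R[) (dg y ^+ 2)%:E <= m%:E)%E ->
  forall y, -1 < y < 1 -> g y ^+ 2 <= 2 * m.
Proof.
move=> cg gN1 m0 gd cdg intg.
have main y z : -1 < y -> y < z -> z < 1 -> (g z - g y) ^+ 2 <= 2 * m.
  move=> y1 yz z1.
  pose k t := dg (clamp y z t) ^+ 2.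
  have ck : continuous k.
    move=> t; have cI := clamp_in t (ltW yz).
    have c1 : {for t, continuous (fun t => dg (clamp y z t))}.
      apply: (@continuous_comp _ _ _ (clamp y z) dg); first exact: clamp_continuous.
      by apply: cdg; lra.
    exact: (continuousM c1 c1).
  have [J dJ JE] := primitive ck yz.
  have JJ : J z - J y <= m.
    rewrite JE /Rintegral -lee_fin fineK; last first.
      by apply: integrable_fin_num => //; exact: integrable_segment.
    apply: le_trans intg.
    have -> : (\int[mu]_(t in `[y, z]) (k t)%:E = \int[mu]_(t in `[y, z]) (dg t ^+ 2)%:E)%E.
      by apply: eq_integral => t; rewrite inE /= in_itv /= => tI; rewrite /k clamp_id.
    have cd : {within `]-1, 1[, continuous (fun t => dg t ^+ 2)}.
      apply: continuous_in_subspaceT => t; rewrite inE /= in_itv /= => tI.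
      exact: (continuousM (cdg _ tI) (cdg _ tI)).
    apply: ge0_subset_integral => //.
    - apply/measurable_EFinP; apply: subspace_continuous_measurable_fun => //.
    - by move=> t _; rewrite lee_fin sqr_ge0.
    by move=> t /=; rewrite !in_itv /=; lra.
  apply: (@le_trans _ _ ((J z - J y) * (z - y))).
    apply: (@sqr_increment_le _ J k g dg) => //.
    - by move=> t tI; exact: derive_cont (dJ _ tI).
    - by move=> t tI; exact: cg.
    - by move=> t tI; apply: dJ; lra.
    - by move=> t tI; apply: gd; lra.
    - by move=> t tI; rewrite /k clamp_id//; lra.
  have : (J z - J y) * (z - y) <= m * (z - y) by apply: ler_wpM2r => //; lra.
  have : m * (z - y) <= m * 2 by apply: ler_wpM2l => //; lra.
  by lra.
move=> y yI; rewrite -subr_ge0.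
have -> : 2 * m - g y ^+ 2 = 2 * m - (g y - g (-1)) ^+ 2 by rewrite gN1 subr0.
have cD : {for -1, continuous (fun z => 2 * m - (g y - g z) ^+ 2)}.
  have c1 : {for -1, continuous (fun z => g y - g z)}.
    by apply: continuousB; [exact: cst_continuous|exact: cg].
  by apply: continuousB; [exact: cst_continuous|exact: (continuousM c1 c1)].
have y1 : -1 < y by lra.
by apply: (ge0_left_end y1 cD) => z zI; rewrite subr_ge0; apply: main; lra.
Qed.

Lemma is_derive_ex f x y : derivable f (x, y) ex ->
  is_derive x 1 (fun t => f (t, y)) ('D_ex f (x, y)).
Proof.
have E : (fun h : R => h^-1 *: ((f \o shift (x, y)) (h *: ex) - f (x, y))) =
  (fun h : R => h^-1 *: (((fun t => f (t, y)) \o shift x) (h *: 1) - f (x, y))).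
  apply/funext => h /=; congr (_ *: (f _ - _)).
  by congr pair; rewrite /= ?/GRing.scale /= ?mulr0 ?add0r.
by move=> d; split; [move: d|]; rewrite /derivable /derive E.
Qed.

Lemma is_derive_ey f x y : derivable f (x, y) ey ->
  is_derive y 1 (fun t => f (x, t)) ('D_ey f (x, y)).
Proof.
have E : (fun h : R => h^-1 *: ((f \o shift (x, y)) (h *: ey) - f (x, y))) =
  (fun h : R => h^-1 *: (((fun t => f (x, t)) \o shift y) (h *: 1) - f (x, y))).
  apply/funext => h /=; congr (_ *: (f _ - _)).
  by congr pair; rewrite /= ?/GRing.scale /= ?mulr0 ?add0r.
by move=> d; split; [move: d|]; rewrite /derivable /derive E.
Qed.

(** A continuous extension to the plane, as [strip_C2] asks; for a stream function it is the
    extension by 0. *)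
Definition clamped f (x y : R) : R := f (x, clamp (-1) 1 y).

Lemma clampedE f x y : -1 <= y <= 1 -> clamped f x y = f (x, y).
Proof. by move=> yI; rewrite /clamped clamp_id. Qed.

Lemma clamped_continuous f : {within strip, continuous f} ->
  continuous (fun z : R * R => clamped f z.1 z.2).
Proof.
move=> /subspace_continuousP cf [x y].
have sI z : strip (z.1, clamp (-1) 1 z.2 : R) by rewrite /strip /=; apply: clamp_in; lra.
have cp : {for (x, y), continuous (fun z : R * R => (z.1, clamp (-1) 1 z.2))}.
  apply: (@cvg_pair _ _ _ (nbhs (x, y)) (nbhs x) (nbhs (clamp (-1) 1 y)) _ _ _
    fst (fun z => clamp (-1) 1 z.2)); first exact: cvg_fst.
  exact: (@cvg_comp _ _ _ snd (clamp (-1) 1) _ _ _ cvg_snd (@clamp_continuous (-1) 1 y)).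
move=> B /= hB; have h := cf _ (sI (x, y)) B hB.
have := cp _ h; rewrite /nbhs /=; apply: filterS => z hz; exact: (hz (sI z)).
Qed.

Lemma near_strip (y : R) : -1 < y < 1 -> \forall t \near y, -1 < t < 1.
Proof.
by move=> /andP[y1 y2]; near=> t; apply/andP; split; near: t;
  [exact: lt_nbhsr|exact: lt_nbhsl].
Unshelve. all: by end_near. Qed.

Lemma slice_continuous_x f x y : {for (x, y), continuous f} ->
  {for x, continuous (fun t => f (t, y))}.
Proof.
move=> cf; apply: (@continuous_comp _ _ _ (fun t => (t, y)) f) => //.
by apply: (@cvg_pair _ _ _ _ (nbhs x) (nbhs y)); [exact: cvg_id|exact: cvg_cst].
Qed.

Lemma slice_continuous_y f x y : {for (x, y), continuous f} ->
  {for y, continuous (fun t => f (x, t))}.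
Proof.
move=> cf; apply: (@continuous_comp _ _ _ (fun t => (x, t)) f) => //.
by apply: (@cvg_pair _ _ _ _ (nbhs x) (nbhs y)); [exact: cvg_cst|exact: cvg_id].
Qed.

Lemma stream_strip_C2 psi : C2_int psi -> {within strip, continuous psi} ->
  strip_C2 (clamped psi) (fun x y => 'D_ex psi (x, y))
    (fun x y => 'D_ex ('D_ex psi) (x, y)) (fun x y => 'D_ey psi (x, y))
    (fun x y => 'D_ey ('D_ey psi) (x, y)).
Proof.
move=> [c1 c2x c2y] cpsi; split; first exact: clamped_continuous.
- move=> y yI x _; have zI : strip_int (x, y) by [].
  have [d1 _ _ _] := c1 _ zI; have [d2 _ cc _] := c2x _ zI.
  split.
  + have -> : (clamped psi)^~ y = (fun t => psi (t, y)).
      by apply/funext => t; rewrite clampedE//; lra.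
    exact: is_derive_ex.
  + exact: is_derive_ex.
  + exact: slice_continuous_x cc.
- move=> x y yI; have zI : strip_int (x, y) by [].
  have [_ d1 _ _] := c1 _ zI; have [_ d2 _ cc] := c2y _ zI.
  split.
  + apply: (near_eq_is_derive _ (is_derive_ey d1)).
    apply: filterS (near_strip yI) => t tI.
    by rewrite clampedE//; lra.
  + exact: is_derive_ey.
  + exact: slice_continuous_y cc.
Qed.

Lemma norm_fst_le (z : R * R) : `|z.1| <= enorm z.
Proof. by rewrite /enorm -sqrtr_sqr ler_wsqrtr// lerDl sqr_ge0. Qed.

Lemma norm_snd_le (z : R * R) : `|z.2| <= enorm z.
Proof. by rewrite /enorm -sqrtr_sqr ler_wsqrtr// lerDr sqr_ge0. Qed.

Lemma enorm_ge0 (z : R * R) : 0 <= enorm z.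
Proof. exact: sqrtr_ge0. Qed.

Lemma C1alpha_norm_le (al eps : R) omega :
  (C1alpha_norm al omega <= eps%:E)%E ->
  [/\ forall z, strip z -> `|omega z| <= eps,
      forall z, strip z -> enorm (strip_grad omega z) <= eps &
      forall z z', strip z -> strip z' -> z <> z' ->
        enorm (strip_grad omega z - strip_grad omega z') <= eps * enorm (z - z') `^ al].
Proof.
rewrite /C1alpha_norm /C1_norm /holder_seminorm.
set A := ereal_sup _; set B := ereal_sup _; set C := ereal_sup _ => h.
(* Two distinct points of the strip show that the three suprema are nonnegative, so each of them is
   at most their sum. *)
have s0 : strip (0 : R * R) by rewrite /strip /=; lra.
have s1 : strip (ex : R * R) by rewrite /strip /=; lra.
have A1 z : strip z -> (`|omega z|%:E <= A)%E by move=> sz; apply: ereal_sup_ubound; exists z.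
have B1 z : strip z -> ((enorm (strip_grad omega z))%:E <= B)%E.
  by move=> sz; apply: ereal_sup_ubound; exists z.
have C1 z z' : strip z -> strip z' -> z <> z' ->
    ((enorm (strip_grad omega z - strip_grad omega z') / enorm (z - z') `^ al)%:E <= C)%E.
  by move=> sz sz' zz'; apply: ereal_sup_ubound; exists (z, z').
have A0 : (0 <= A)%E by apply: le_trans (A1 _ s0); rewrite lee_fin.
have B0 : (0 <= B)%E by apply: le_trans (B1 _ s0); rewrite lee_fin enorm_ge0.
have C0 : (0 <= C)%E.
  apply: le_trans (C1 0 ex s0 s1 _); last by case=> /esym/eqP; rewrite oner_eq0.
  by rewrite lee_fin divr_ge0 ?enorm_ge0 ?powR_ge0.
have hA : (A <= eps%:E)%E.
  by apply: le_trans h; rewrite -addeA leeDl// adde_ge0.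
have hB : (B <= eps%:E)%E.
  by apply: le_trans h; rewrite addeAC leeDr// adde_ge0.
have hC : (C <= eps%:E)%E.
  by apply: le_trans h; rewrite leeDr// adde_ge0.
split.
- by move=> z sz; rewrite -lee_fin; apply: le_trans (A1 _ sz) hA.
- by move=> z sz; rewrite -lee_fin; apply: le_trans (B1 _ sz) hB.
- move=> z z' sz sz' zz'; rewrite -ler_pdivrMr; last first.
    apply: powR_gt0; rewrite lt_neqAle enorm_ge0 andbT eq_sym; apply/eqP => e.
    apply: zz'; have := norm_fst_le (z - z'); have := norm_snd_le (z - z').
    rewrite e !normr_le0 !subr_eq0 => /eqP e2 /eqP e1.
    by rewrite (surjective_pairing z) (surjective_pairing z') e1 e2.
  by rewrite -lee_fin; apply: le_trans (C1 _ _ sz sz' zz') hC.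
Qed.

End Translation.

Section Decay.
Context {R : realType}.
Implicit Types (psi omega : R * R -> R).

Lemma stream_out omega psi : stream_function omega psi ->
  forall x y : R, ~~ (-1 < y < 1) -> clamped psi x y = 0.
Proof.
move=> sf x y; rewrite negb_and -!leNgt /clamped => /orP[y1|y1].
  by rewrite /clamp max_l ?(stream_bottom sf)// ge_min y1 orbT.
by rewrite /clamp min_l// max_r ?(stream_top sf)//; lra.
Qed.

Lemma stream_decay omega psi : stream_function omega psi ->
  forall N m : R, 0 < m ->
  (exists2 a, N < a & forall y, `|clamped psi a y| <= m) /\
  (exists2 a, a < N & forall y, `|clamped psi a y| <= m).
Proof.
move=> sf N m m0; have m2 : 0 < m ^+ 2 / 2 by rewrite divr_gt0// exprn_gt0.
have C2 := stream_strip_C2 (stream_C2 sf) (stream_continuous sf).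
have [_ _ yC2] := C2.
have small a : (\int[lebesgue_measure]_(y in `](-1)%R, 1%R[)
      ('D_ey psi (a, y) ^+ 2)%:E <= (m ^+ 2 / 2)%:E)%E ->
    forall y, `|clamped psi a y| <= m.
  move=> ha y.
  have [yI|/(stream_out sf) ->] := boolP (-1 < y < 1); last by rewrite normr0 ltW.
  rewrite -(@ler_pXn2r _ 2) ?nnegrE//; last exact: ltW.
  rewrite -normrX ger0_norm ?sqr_ge0//.
  have -> : m ^+ 2 = 2 * (m ^+ 2 / 2) by rewrite mulrCA divff ?mulr1// pnatr_eq0.
  apply: (@slice_sup_le _ (clamped psi a) (fun y => 'D_ey psi (a, y))) => //.
  - exact: strip_C2_slice C2.
  - by apply: (stream_out sf); lra.
  - exact: ltW.
  - by move=> z zI; have [] := yC2 a z zI.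
  - by move=> z zI; have [_ d _] := yC2 a z zI; exact: derive_cont d.
split.
- have [||a] := L2_small_slice (stream_dy_L2 sf) (A := `]N, +oo[) _ _ m2.
  + exact: measurable_itv.
  + by rewrite lebesgue_measure_itv /= ltry.
  by rewrite /= in_itv /= andbT => Na /small; exists a.
- have [||a] := L2_small_slice (stream_dy_L2 sf) (A := `]-oo, N[) _ _ m2.
  + exact: measurable_itv.
  + by rewrite lebesgue_measure_itv /= ltNyr.
  by rewrite /= in_itv /= => Na /small; exists a.
Qed.

End Decay.

(** * Choice of the constant and conclusion *)

Theorem theorem1p7 (R : realType) (alpha : R) (alpha_gt0 : 0 < alpha) :
  exists2 eps : R, 0 < eps &
    forall (c : R) (omega : R * R -> R),
      L2_on strip omega ->
      C1_strip omega ->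
      (C1alpha_norm alpha omega <= eps%:E)%E ->
      traveling_wave c omega ->
      forall z : R * R, strip z -> omega z = 0.
Proof.
pose C : R := 10 + 12 * (2 `^ alpha / alpha).
have C0 : 0 < C.
  have : 0 <= 2 `^ alpha / alpha by rewrite divr_ge0 ?powR_ge0// ltW.
  by rewrite /C; lra.
pose eps := Num.min (1 / 6) (C^-1 / 2).
have eps0 : 0 < eps by rewrite lt_min; rewrite !divr_gt0// invr_gt0.
have eps6 : eps <= 1 / 6 by rewrite ge_min lexx.
have epsC : eps * C <= 1 / 2.
  have : eps <= C^-1 / 2 by rewrite ge_min lexx orbT.
  move=> /(ler_wpM2r (ltW C0)) /le_trans; apply.
  by rewrite mulrAC mulVf ?gt_eqF.
exists eps => // c omega _ [comega domega _] /C1alpha_norm_le [n1 n2 n3].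
move=> [psi sf tw] [x y] sz.
have C2 := stream_strip_C2 (stream_C2 sf) (stream_continuous sf).
have int (t s : R) : -1 < s < 1 -> strip_int (t, s) by [].
have intS (t s : R) : -1 < s < 1 -> strip (t, s).
  by move=> sI; rewrite /strip /=; lra.
have dx (t s : R) : -1 < s < 1 -> derivable omega (t, s) ex.
  by move=> sI; rewrite -strip_derivableE//; have [] := domega _ (intS t s sI).
have gradE (t s : R) : -1 < s < 1 ->
    strip_grad omega (t, s) = ('D_ex omega (t, s), 'D_ey omega (t, s)).
  by move=> sI; rewrite /strip_grad !strip_deriveE.
have enormx (t t' s : R) : enorm ((t, s) - (t', s)) = `|t - t'|.
  by rewrite /enorm /= subrr expr0n addr0 sqrtr_sqr.
have enormy (t s s' : R) : enorm ((t, s) - (t, s')) = `|s - s'|.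
  by rewrite /enorm /= subrr expr0n add0r sqrtr_sqr.
have out := stream_out sf.
have poisson (t s : R) : -1 < s < 1 ->
    - ('D_ex ('D_ex psi) (t, s) + 'D_ey ('D_ey psi) (t, s)) = clamped omega t s.
  by move=> sI; rewrite clampedE ?(stream_poisson sf (int t s sI))//; lra.
have [c1 c2x _] := stream_C2 sf.
have cx (t s : R) : -1 < s < 1 -> {for s, continuous (fun s => 'D_ex psi (t, s))}.
  move=> sI; have [_ _ cc _] := c1 _ (int t s sI).
  exact: slice_continuous_y cc.
have cxx (t s : R) : -1 < s < 1 ->
    {for s, continuous (fun s => 'D_ex ('D_ex psi) (t, s))}.
  move=> sI; have [_ _ cc _] := c2x _ (int t s sI).
  exact: slice_continuous_y cc.
have cw t : continuous (clamped omega t).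
  move=> s; apply: (@continuous2_comp _ _ (clamped omega) (cst t) id).
  - exact: clamped_continuous.
  - exact: cst_continuous.
  - exact: id.
have w_le (t s : R) : -1 < s < 1 -> `|clamped omega t s| <= eps.
  by move=> sI; rewrite clampedE ?(n1 _ (intS t s sI))//; lra.
have dw (t s : R) : -1 < s < 1 ->
    is_derive t 1 ((clamped omega)^~ s) ('D_ex omega (t, s)).
  move=> sI; have -> : (clamped omega)^~ s = (fun t => omega (t, s)).
    by apply/funext => r; rewrite clampedE//; lra.
  exact/is_derive_ex/dx.
have wx_le (t s : R) : -1 < s < 1 -> `|'D_ex omega (t, s)| <= eps.
  move=> sI; have := n2 _ (intS t s sI); rewrite gradE//.
  exact: le_trans (norm_fst_le (_, _)).
have wy_le (t s : R) : -1 < s < 1 -> `|'D_ey omega (t, s)| <= eps.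
  move=> sI; have := n2 _ (intS t s sI); rewrite gradE//.
  exact: le_trans (norm_snd_le (_, _)).
have wx_holder (t t' s : R) : -1 < s < 1 ->
    `|'D_ex omega (t, s) - 'D_ex omega (t', s)| <= eps * `|t - t'| `^ alpha.
  move=> sI; have [->|tt'] := eqVneq t t'.
    by rewrite !subrr normr0 mulr_ge0 ?powR_ge0// ltW.
  have ne : (t, s) <> (t', s) by case=> e; rewrite e eqxx in tt'.
  have := n3 _ _ (intS t s sI) (intS t' s sI) ne.
  rewrite !gradE// enormx; apply: le_trans.
  exact: (norm_fst_le (_ - _, _ - _)).
have wy_holder (t s s' : R) : -1 < s < 1 -> -1 < s' < 1 ->
    `|'D_ey omega (t, s) - 'D_ey omega (t, s')| <= eps * `|s - s'| `^ alpha.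
  move=> sI sI'; have [->|ss'] := eqVneq s s'.
    by rewrite !subrr normr0 mulr_ge0 ?powR_ge0// ltW.
  have ne : (t, s) <> (t, s') by case=> e; rewrite e eqxx in ss'.
  have := n3 _ _ (intS t s sI) (intS t s' sI') ne.
  rewrite !gradE// enormy; apply: le_trans.
  exact: (norm_snd_le (_ - _, _ - _)).
have transport (t s : R) : -1 < s < 1 ->
    (s - c + 'D_ey psi (t, s)) * 'D_ex omega (t, s) =
    'D_ex psi (t, s) * 'D_ey omega (t, s).
  move=> sI; have := tw _ (int t s sI); rewrite /velocity /= mulNr.
  by move/eqP; rewrite subr_eq0 => /eqP.
have w0 s : -1 < s < 1 -> clamped omega x s = 0.
  by move=> sI; exact: (w_eq0 alpha_gt0 eps0 C2 out poisson cx cxx cw w_le dw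
    wx_le wy_le wx_holder wy_holder transport (stream_decay sf) eps6 epsC).
(* The equations hold in the open strip; the walls are reached by continuity of omega, through the
   nonnegativity of [- |omega|]. *)
have cn s : {for s, continuous (fun s => - `|clamped omega x s|)}.
  by apply: continuousN; exact: (continuous_comp (cw x s) (@norm_continuous _ _ _)).
have lt11 : -1 < 1 :> R by lra.
have n0 s : -1 < s < 1 -> 0 <= - `|clamped omega x s|.
  by move=> /w0 ->; rewrite normr0 oppr0.
have sz' : -1 <= y <= 1 by exact: sz.
rewrite -(clampedE omega x sz'); apply/normr0_eq0/eqP.
rewrite eq_le normr_ge0 andbT -oppr_ge0.
have [yI|yI] := boolP (-1 < y < 1); first exact: n0.
have [->|->] : y = -1 \/ y = 1.
  move: yI; rewrite negb_and -!leNgt => /orP[y1|y1]; [left|right]; lra.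
- exact: (ge0_left_end lt11 (cn (-1)) n0).
- exact: (ge0_right_end lt11 (cn 1) n0).
Qed.
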